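(* Let $q\ge 2$ be an integer. There is a sequence of $(q+1)$-regular graphs of groups $\mathbf{X}_N=(X_N,\mathcal{G}_N)$, $N\ge 1$, such that the pole-free regions of $Z_{\mathbf{X}_N}$ converge to $\{u\in\mathbb{C}: |u|\le \tfrac1q\}$ as $N\to\infty$; that is, if $\rho_N$ denotes the supremum of the radii of the pole-free regions of $Z_{\mathbf{X}_N}$, then $\rho_N\to \frac1q$ as $N\to\infty$.
   Context: Graphs have oriented edges $e$ with source $s(e)$, target $t(e)$ and inverse $\overline{e}\neq e$. A graph of groups $\mathbf{X}=(X,\mathcal{G})$ is a graph $X$ with (here finite) groups $G_x$ (vertices), $G_e=G_{\overline e}$ (edges) and monomorphisms $G_e\to G_{t(e)}$. It is $(q+1)$-regular if its universal covering (Bass–Serre) tree $\mathcal{T}$ is $(q+1)$-regular, i.e. $\sum_{s(e)=x}|G_x|/|G_e|=q+1$ for each vertex $x$. Its fundamental group $\Gamma=\pi_1(X,\mathcal{G})$ acts on $\mathcal{T}$ without inversions. An element $\gamma\in\Gamma$ is hyperbolic if it fixes no vertex of $\mathcal{T}$; $\ell(\gamma)=\min_x d(x,\gamma x)$ is its translation length; it is primitive if $\gamma\ne h^r$ for all $h\in\Gamma$, $r>1$. The zeta function of $\mathbf{X}$ is $Z_{\mathbf X}(u)=\prod_{[\gamma]}(1-u^{\ell(\gamma)})^{-1}$, the product over $\Gamma$-conjugacy classes of primitive hyperbolic elements, for $|u|$ small, and its meromorphic continuation. Let $R_{\mathbf X}$ be the radius of convergence of $Z_{\mathbf X}(u)$.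 A pole-free region of $Z_{\mathbf X}$ is a disc $\{u\in\mathbb{C}:|u|<R_{\mathbf X}+\epsilon\}$ with $\epsilon>0$ such that every pole of $Z_{\mathbf X}(u)$ in the region $R_{\mathbf X}\le|u|\le R_{\mathbf X}+\epsilon$ lies on the circle $|u|=R_{\mathbf X}$; its radius is $R_{\mathbf X}+\epsilon$. *)

(* Defs.v *)
From HB Require Import structures.
From mathcomp Require Import all_boot all_order all_fingroup all_algebra.
From mathcomp Require Import generic_quotient.
From mathcomp Require Import all_classical all_reals all_analysis.
From mathcomp Require Import finmap.
From mathcomp Require Import complex.
From mathcomp.analysis.showcase Require Import summability.

Set Implicit Arguments.
Unset Strict Implicit.
Unset Printing Implicit Defensive.

Import Order.TTheory GRing.Theory Num.Theory numFieldNormedType.Exports.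

Local Open Scope classical_set_scope.
Local Open Scope card_scope.

(* A graph with oriented edges.  The source of an edge is not a field, because
   it is the target of the inverse edge. *)
Record graph := Graph {
  vert : Type;
  edge : Type;
  tgt : edge -> vert;
  einv : edge -> edge;
  einvK : involutive einv;
  einv_neq : forall e, einv e <> e }.

Definition src (G : graph) (e : edge G) : vert G := tgt (einv e).

Fixpoint walk (G : graph) (n : nat) (v w : vert G) : Prop :=
  if n is m.+1 then exists e : edge G, src e = v /\ walk m (tgt e) w
  else v = w.

Definition connected_graph (G : graph) :=
  forall v w : vert G, exists n, walk n v w.

Definition regular_graph (G : graph) (d : nat) :=
  forall v : vert G, [set e : edge G | src e = v] #= `I_d.

(* 0 if [A] is empty. *)
Definition nat_min (A : set nat) : nat :=
  xget 0%N [set n | A n /\ forall m, A m -> (n <= m)%N].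

Definition dist (G : graph) (v w : vert G) : nat :=
  nat_min [set n | walk n v w].

(* The groups [egrp e] and [egrp (einv e)] are the same group in the
   mathematics; here they are identified by the isomorphism [eident e].
   The monomorphism [emb e] goes from the group of [e] to that of its target.
   The base vertex is used for the construction of the fundamental group and
   of the covering tree; the graph being connected, another choice gives
   isomorphic objects. *)
Record graph_of_groups := GraphOfGroups {
  ugraph :> graph;
  ugraph_connected : connected_graph ugraph;
  base : vert ugraph;
  vgrp : vert ugraph -> finGroupType;
  egrp : edge ugraph -> finGroupType;
  eident : forall e, egrp e -> egrp (einv e);
  eidentM : forall e, {morph @eident e : g h / (g * h)%g};
  eidentK : forall e (g : egrp e),
    existT egrp _ (eident (eident g)) = existT egrp e g;
  emb : forall e, egrp e -> vgrp (tgt e);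
  embM : forall e, {morph @emb e : g h / (g * h)%g};
  emb_inj : forall e, injective (@emb e) }.

Section PathGroup.
Variable X : graph_of_groups.

Definition letter : Type := ({x : vert X & vgrp x} + edge X)%type.

Definition vletter (x : vert X) (g : vgrp x) : letter :=
  inl (existT (fun x => vgrp x : Type) x g).
Definition eletter (e : edge X) : letter := inr e.

Definition word : Type := seq letter.
HB.instance Definition _ := gen_eqMixin word.
HB.instance Definition _ := gen_choiceMixin word.

(* The relations are those of the groups [vgrp x], [e * einv e = 1], and
   [e * (emb e g) * (einv e) = emb (einv e) g] for [g] in the group of [e]. *)
Inductive weq : word -> word -> Prop :=
| weq_refl w : weq w w
| weq_sym w w' : weq w w' -> weq w' w
| weq_trans w w' w'' : weq w w' -> weq w' w'' -> weq w w''
| weq_cat w1 w1' w2 w2' : weq w1 w1' -> weq w2 w2' -> weq (w1 ++ w2) (w1' ++ w2')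
| weq_one x : weq [:: @vletter x 1%g] [::]
| weq_mul x (g h : vgrp x) : weq [:: vletter g; vletter h] [:: vletter (g * h)%g]
| weq_einv e : weq [:: eletter e; eletter (einv e)] [::]
| weq_edge e (g : egrp e) :
    weq [:: eletter e; vletter (emb g); eletter (einv e)]
        [:: vletter (emb (eident g))].

Definition weqb : rel word := fun w w' => `[< weq w w' >].

Lemma weqb_refl : reflexive weqb.
Proof. by move=> w; apply/asboolP; exact: weq_refl. Qed.

Lemma weqb_sym : symmetric weqb.
Proof. by move=> w w'; apply/asboolP/asboolP; exact: weq_sym. Qed.

Lemma weqb_trans : transitive weqb.
Proof. by move=> y x z /asboolP xy /asboolP yz; apply/asboolP; exact: weq_trans xy yz. Qed.

Canonical weq_equiv := EquivRel weqb weqb_refl weqb_sym weqb_trans.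

Definition path_group : Type := {eq_quot weq_equiv}%qT.
HB.instance Definition _ := Choice.on path_group.

Definition cls (w : word) : path_group := (\pi_({eq_quot weq_equiv}) w)%qT.

Lemma clsP w w' : cls w = cls w' <-> weq w w'.
Proof. by split=> [/eqquotP/asboolP | H] //; apply/eqquotP/asboolP. Qed.

Lemma cls_surj (p : path_group) : exists w, cls w = p.
Proof. by exists (repr p); rewrite /cls reprK. Qed.

Definition wrep (p : path_group) : word := repr p.

Lemma wrepK p : cls (wrep p) = p.
Proof. by rewrite /cls reprK. Qed.

Definition linv (l : letter) : letter :=
  match l with
  | inl s => vletter (projT2 s)^-1%g
  | inr e => eletter (einv e)
  end.

Definition winv (w : word) : word := rev [seq linv l | l <- w].

Lemma linvK : involutive linv.
Proof.
by move=> [[x g]|e] /=; rewrite /vletter /eletter /= ?invgK ?einvK.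
Qed.

Lemma winvK : involutive winv.
Proof.
move=> w; rewrite /winv map_rev revK -map_comp -[RHS]map_id.
by apply: eq_map => l /=; exact: linvK.
Qed.

Lemma linvl l : weq [:: linv l; l] [::].
Proof.
have linvr k : weq [:: k; linv k] [::].
  case: k => [[x g]|e] /=; last exact: weq_einv.
  apply: weq_trans (weq_mul _ _) _.
  by rewrite mulgV; exact: weq_one.
by have := linvr (linv l); rewrite linvK.
Qed.

Lemma winvl w : weq (winv w ++ w) [::].
Proof.
elim: w => [|l w IHw]; first exact: weq_refl.
rewrite /winv map_cons rev_cons cat_rcons.
apply: weq_trans IHw; apply: weq_cat; first exact: weq_refl.
by apply: (@weq_cat [:: _; _] [::]); [exact: linvl | exact: weq_refl].
Qed.

Lemma winvr w : weq (w ++ winv w) [::].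
Proof. by have := winvl (winv w); rewrite winvK. Qed.

Definition pmul (p q : path_group) : path_group := cls (wrep p ++ wrep q).
Definition pone : path_group := cls [::].
Definition pinv (p : path_group) : path_group := cls (winv (wrep p)).

Lemma pmul_cls w w' : pmul (cls w) (cls w') = cls (w ++ w').
Proof. by apply/clsP; apply: weq_cat; apply/clsP; rewrite wrepK. Qed.

Fact pmulA : associative pmul.
Proof.
by move=> p q r; rewrite -[p]wrepK -[q]wrepK -[r]wrepK !pmul_cls catA.
Qed.

Fact pmul1 : left_id pone pmul.
Proof. by move=> p; rewrite -[p]wrepK pmul_cls. Qed.

Fact p1mul : right_id pone pmul.
Proof. by move=> p; rewrite -[p]wrepK pmul_cls cats0. Qed.

Fact pmulV : left_inverse pone pinv pmul.
Proof. by move=> p; rewrite -[X in pmul _ X]wrepK pmul_cls; apply/clsP/winvl. Qed.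

Fact pVmul : right_inverse pone pinv pmul.
Proof. by move=> p; rewrite -[X in pmul X _]wrepK pmul_cls; apply/clsP/winvr. Qed.

HB.instance Definition _ := isGroup.Build path_group pmulA pmul1 p1mul pmulV pVmul.

Lemma clsM w w' : cls (w ++ w') = (cls w * cls w')%g.
Proof. by rewrite -pmul_cls. Qed.

Lemma cls1 : cls [::] = 1%g.
Proof. by []. Qed.

Lemma clsV w : cls (winv w) = (cls w)^-1%g.
Proof.
apply: (mulIg (cls w)); rewrite mulVg -clsM -cls1; apply/clsP; exact: winvl.
Qed.

(* [wpath x y w]: the edges of [w] form a path from [x] to [y] in the graph and
   each letter of a vertex group is read while standing at that vertex. *)
Fixpoint wpath (x y : vert X) (w : word) : Prop :=
  match w with
  | [::] => x = y
  | inl s :: w' => projT1 s = x /\ wpath x y w'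
  | inr e :: w' => src e = x /\ wpath (tgt e) y w'
  end.

Lemma wpath_cat x y z w w' :
  wpath x y w -> wpath y z w' -> wpath x z (w ++ w').
Proof.
elim: w x => [|[s|e] w IHw] x /=; first by move->.
- by move=> [-> ?] ?; split=> //; exact: IHw.
- by move=> [-> ?] ?; split=> //; exact: IHw.
Qed.

Lemma wpath_inv x y w : wpath x y w -> wpath y x (winv w).
Proof.
elim: w x => [|l w IHw] x; first by move=> ->.
rewrite /winv map_cons rev_cons -cats1; case: l => [s|e] /= [<- p].
- by apply: wpath_cat (IHw _ p) _.
- by apply: wpath_cat (IHw _ p) _; rewrite /= /src einvK.
Qed.

Definition pi_set (x y : vert X) : set path_group :=
  [set p | exists2 w, wpath x y w & cls w = p].

Lemma pi_setM x y z p q : pi_set x y p -> pi_set y z q -> pi_set x z (p * q)%g.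
Proof.
move=> [w pw <-] [w' pw' <-]; exists (w ++ w'); last exact: clsM.
exact: wpath_cat pw pw'.
Qed.

Lemma pi_setV x y p : pi_set x y p -> pi_set y x p^-1%g.
Proof.
by move=> [w pw <-]; exists (winv w); [exact: wpath_inv | exact: clsV].
Qed.

Lemma pi_set1 x : pi_set x x 1%g.
Proof. by exists [::]. Qed.

Lemma pi_set_edge (e : edge X) : pi_set (src e) (tgt e) (cls [:: eletter e]).
Proof. by exists [:: eletter e]. Qed.

Definition pi1_pred : pred path_group := fun p => `[< pi_set (base X) (base X) p >].

Definition pi1 : Type := {p : path_group | pi1_pred p}.
HB.instance Definition _ := SubChoice.on pi1.

Fact pi1_group_closed : group_closed pi1_pred.
Proof.
split=> [|p q /asboolP pp /asboolP pq]; apply/asboolP; first exact: pi_set1.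
by apply: pi_setM pp _; exact: pi_setV.
Qed.

HB.instance Definition _ :=
  SubChoice_isSubGroup.Build path_group pi1_pred pi1 pi1_group_closed.

Lemma pi1P (g : pi1) : pi_set (base X) (base X) (\val g).
Proof. by apply/asboolP; exact: valP g. Qed.

(* The images of the vertex group of [x], and of the edge group of [e] inside
   the group of the source of [e], in the path group. *)
Definition vsub (x : vert X) : set path_group :=
  range (fun g : vgrp x => cls [:: vletter g]).

Definition esub (e : edge X) : set path_group :=
  range (fun g : egrp (einv e) => cls [:: vletter (emb g)]).

Definition lmul (p : path_group) (A : set path_group) : set path_group :=
  [set (p * a)%g | a in A].

Definition rmul (A : set path_group) (p : path_group) : set path_group :=
  [set (a * p)%g | a in A].

Definition smul (A B : set path_group) : set path_group :=
  [set p | exists a b, [/\ A a, B b & p = (a * b)%g]].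

(* Vertices over [x] are the cosets of [vgrp x] in the paths from the base
   vertex to [x]; edges over [e] are the cosets of the edge group of [e] in the
   paths from the base vertex to the source of [e]. *)
Definition tree_vert_pred (xA : vert X * set path_group) : Prop :=
  exists2 p, pi_set (base X) xA.1 p & xA.2 = lmul p (vsub xA.1).

Definition tree_edge_pred (eA : edge X * set path_group) : Prop :=
  exists2 p, pi_set (base X) (src eA.1) p & eA.2 = lmul p (esub eA.1).

Definition tree_vert : Type := {xA | tree_vert_pred xA}.
Definition tree_edge : Type := {eA | tree_edge_pred eA}.

Lemma tree_vert_eq (v w : tree_vert) : sval v = sval w -> v = w.
Proof. by case: v w => [v pv] [w pw] /= vw; exact: eq_exist. Qed.

Lemma tree_edge_eq (v w : tree_edge) : sval v = sval w -> v = w.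
Proof. by case: v w => [v pv] [w pw] /= vw; exact: eq_exist. Qed.

Lemma lmulM p q A : lmul (p * q)%g A = lmul p (lmul q A).
Proof.
by rewrite /lmul image_comp; congr image; apply/funext => a /=; rewrite mulgA.
Qed.

Lemma rmulM p q A : rmul A (p * q)%g = rmul (rmul A p) q.
Proof.
by rewrite /rmul image_comp; congr image; apply/funext => a /=; rewrite mulgA.
Qed.

Lemma rmul1 A : rmul A 1%g = A.
Proof.
rewrite /rmul -[RHS]image_id; congr image; apply/funext => a; exact: mulg1.
Qed.

Lemma rlmul p q A : rmul (lmul p A) q = lmul p (rmul A q).
Proof.
rewrite /rmul /lmul !image_comp; congr image; apply/funext => a /=.
by rewrite mulgA.
Qed.

Lemma smul_lmul p A B : smul (lmul p A) B = lmul p (smul A B).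
Proof.
apply/seteqP; split.
- move=> _ [_ [b [[a Aa <-] Bb ->]]].
  by exists (a * b)%g; [exists a, b | rewrite mulgA].
- move=> _ [_ [a [b [Aa Bb ->]]] <-]; exists (p * a)%g, b.
  by split=> //; [exists a | rewrite mulgA].
Qed.

Lemma cls_einv e : (cls [:: eletter e] * cls [:: eletter (einv e)])%g = 1%g.
Proof. by rewrite -clsM -cls1; apply/clsP; exact: weq_einv. Qed.

Lemma esub_edge e :
  rmul (esub e) (cls [:: eletter e]) = lmul (cls [:: eletter e]) (esub (einv e)).
Proof.
pose lift (s : {f : edge X & egrp f : Type}) := cls [:: vletter (emb (projT2 s))].
pose ident (s : {f : edge X & egrp f : Type}) :=
  existT (fun f => egrp f : Type) _ (eident (projT2 s)).
have identK s : ident (ident s) = s by case: s => f g; exact: eidentK.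
have rel s : (lift (ident s) * cls [:: eletter (projT1 s)])%g =
             (cls [:: eletter (projT1 s)] * lift s)%g.
  case: s => f g; rewrite /lift /= -2!clsM /=; apply/clsP.
  have := weq_cat (weq_edge g) (weq_refl [:: eletter f]) => /= relg.
  apply: weq_trans (weq_sym relg) _.
  apply: (@weq_cat [:: _; _] [:: _; _] _ [::]); first exact: weq_refl.
  by have := weq_einv (einv f); rewrite einvK.
have liftP f (s : {f : edge X & egrp f : Type}) : projT1 s = f ->
    exists g : egrp f, lift s = cls [:: vletter (emb g)].
  by case: s => f' g <-; exists g.
apply/seteqP; split=> [_ [_ [g _ <-] <-]|_ [_ [g _ <-] <-]].
- pose s := existT (fun f => egrp f : Type) _ g.
  have es : projT1 (ident s) = e by exact: einvK.
  have [h hE] : exists h : egrp (einv (einv e)),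
      lift (ident s) = cls [:: vletter (emb h)] by apply: liftP.
  exists (cls [:: vletter (emb h)]); first by exists h.
  by rewrite -hE -{1}es -rel identK es.
- pose s := existT (fun f => egrp f : Type) _ g.
  have es : projT1 s = e by exact: einvK.
  have [h hE] : exists h : egrp (einv e),
      lift (ident s) = cls [:: vletter (emb h)].
    by apply: liftP; rewrite /= einvK.
  exists (cls [:: vletter (emb h)]); first by exists h.
  by rewrite -hE -{1}es rel es.
Qed.

Lemma smul_esub e : smul (esub (einv e)) (vsub (tgt e)) = vsub (tgt e).
Proof.
have vE f : tgt f = tgt e -> forall g : egrp f,
    exists h : vgrp (tgt e), cls [:: vletter (emb g)] = cls [:: vletter h].
  by move=> <- g; exists (emb g).
have mulE (g h : vgrp (tgt e)) : (cls [:: vletter g] * cls [:: vletter h])%g =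
    cls [:: vletter (g * h)%g].
  by rewrite -clsM; apply/clsP; exact: weq_mul.
have ee : tgt (einv (einv e)) = tgt e by rewrite einvK.
apply/seteqP; split=> [_ [_ [_ [[g _ <-] [h _ <-] ->]]]|_ [h _ <-]].
- by have [k ->] := vE _ ee g; rewrite mulE; exists (k * h)%g.
- have [k kE] := vE _ ee 1%g.
  exists (cls [:: vletter (@emb X (einv (einv e)) 1%g)]).
  exists (cls [:: vletter (k^-1 * h)%g]); split.
  + by exists 1%g.
  + by exists (k^-1 * h)%g.
  + by rewrite kE mulE mulKVg.
Qed.

Fact tree_inv_subproof (eA : tree_edge) :
  tree_edge_pred (einv (sval eA).1, rmul (sval eA).2 (cls [:: eletter (sval eA).1])).
Proof.
case: eA => [[e A] [p pp /= ->]]; exists (p * cls [:: eletter e])%g => /=.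
  by apply: pi_setM pp _; rewrite /src einvK; exact: pi_set_edge.
by rewrite rlmul esub_edge lmulM.
Qed.

Fact tree_tgt_subproof (eA : tree_edge) :
  tree_vert_pred (tgt (sval eA).1,
    smul (rmul (sval eA).2 (cls [:: eletter (sval eA).1])) (vsub (tgt (sval eA).1))).
Proof.
case: eA => [[e A] [p pp /= ->]]; exists (p * cls [:: eletter e])%g => /=.
  by apply: pi_setM pp _; exact: pi_set_edge.
by rewrite rlmul esub_edge -lmulM smul_lmul smul_esub.
Qed.

(* The inverse of the edge [(e, A)] is [(einv e, A e)], and its target is
   [(tgt e, A e G)] where [G] is the group of [tgt e].  Hence its source is
   [(src e, A G)] where [G] is the group of [src e]. *)
Definition tree_inv (eA : tree_edge) : tree_edge :=
  exist tree_edge_pred _ (tree_inv_subproof eA).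
Definition tree_tgt (eA : tree_edge) : tree_vert :=
  exist tree_vert_pred _ (tree_tgt_subproof eA).

Fact tree_invK : involutive tree_inv.
Proof.
case=> [[e A] pA]; apply: tree_edge_eq => /=.
by rewrite einvK -rmulM cls_einv rmul1.
Qed.

Fact tree_inv_neq eA : tree_inv eA <> eA.
Proof. by move=> /(congr1 (fun f => (sval f).1)) /=; exact: einv_neq. Qed.

Definition tree : graph := Graph tree_tgt tree_invK tree_inv_neq.

Fact act_subproof (g : pi1) (v : tree_vert) :
  tree_vert_pred ((sval v).1, lmul (\val g) (sval v).2).
Proof.
case: v => [[x A] [p pp /= ->]]; exists (\val g * p)%g => /=.
  by apply: pi_setM pp; exact: pi1P.
by rewrite lmulM.
Qed.

Definition act (g : pi1) (v : vert tree) : vert tree :=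
  exist tree_vert_pred _ (act_subproof g v).

Definition hyperbolic (g : pi1) := forall v, act g v <> v.

Definition translation_length (g : pi1) : nat :=
  nat_min (range (fun v => dist v (act g v))).

Definition primitive (g : pi1) :=
  forall (h : pi1) (r : nat), (1 < r)%N -> g <> (h ^+ r)%g.

Definition conj_class (g : pi1) : set pi1 := range (fun h : pi1 => (g ^ h)%g).

Definition prime_class : Type :=
  {c : set pi1 | exists g, [/\ hyperbolic g, primitive g & c = conj_class g]}.
HB.instance Definition _ := gen_eqMixin prime_class.
HB.instance Definition _ := gen_choiceMixin prime_class.

(* The translation length is constant on a conjugacy class. *)
Definition class_length (c : prime_class) : nat :=
  nat_min (translation_length @` sval c).

End PathGroup.

Definition regular_gog (d : nat) (X : graph_of_groups) := regular_graph (tree X) d.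

Section Meromorphic.
Variable C : numFieldType.
Local Open Scope ring_scope.
Implicit Types (f : C -> C) (z : C).

Definition holomorphic_near f z :=
  \forall w \near z, derivable (f : C^o -> C^o) w 1.

(* A meromorphic function is given by a total function, the values of which at
   its singularities are irrelevant. *)
Definition meromorphic f := forall z, exists (n : nat) (g : C -> C),
  holomorphic_near g z /\ \forall w \near z^', f w = g w / (w - z) ^+ n.

Definition is_pole f z := `|f w| @[w --> z^'] --> +oo.

End Meromorphic.

Section Zeta.
Variables (R : realType) (X : graph_of_groups).
Local Notation C := [the numFieldType of R[i]].
Local Open Scope ring_scope.

(* Unconditional convergence: the limit is taken along the directed set of the
   finite subsets of [prime_class X]. *)
Definition zeta_product (u z : C) : Prop :=
  (fun A : {fset prime_class X} => \prod_(c <- A) (1 - u ^+ class_length c)^-1)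
    @ @totally [the choiceType of prime_class X] --> z.

Definition zeta_continuation (Z : C -> C) : Prop :=
  meromorphic Z /\ \forall u \near (0 : C), zeta_product u (Z u).

Definition zeta_expansion (a : nat -> C) : Prop :=
  \forall u \near (0 : C),
    exists2 z : C, [series a n * u ^+ n]_n @ \oo --> z & zeta_product u z.

(* The radius of convergence of the power series expansion at 0; this expansion
   is unique. *)
Definition zeta_radius : \bar R :=
  ereal_sup [set r%:E | r in [set r : R | 0 <= r /\
    exists2 a, zeta_expansion a &
      forall u : C, `|u| < r%:C%C -> cvgn [series a n * u ^+ n]_n]].

Definition cabs (u : C) : R := complex.Re `|u|.

(* No radius is pole-free if [zeta_radius] is infinite. *)
Definition pole_free_radius (Z : C -> C) (rho : R) : Prop :=
  exists eps : R, [/\ 0 < eps, rho%:E = (zeta_radius + eps%:E)%E &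
    forall u, is_pole Z u -> (zeta_radius <= (cabs u)%:E <= rho%:E)%E ->
      (cabs u)%:E = zeta_radius].

Definition pole_free_sup (Z : C -> C) : \bar R :=
  ereal_sup [set rho%:E | rho in pole_free_radius Z].

End Zeta.

(* Main.v *)
Require Import Defs.
From mathcomp Require Import all_boot all_order fingroup all_algebra.
From mathcomp Require Import all_classical all_reals all_analysis.
From mathcomp Require Import finmap complex ring lra zify.
From mathcomp.analysis.showcase Require Import summability.

(* For a finite graph all of whose groups are trivial, the path group is the free
   groupoid on the edges, hyperbolic conjugacy classes are the cyclically reduced
   closed words up to rotation, and the classes of primitive elements are the
   primitive words.  If [x_1, ..., x_r] are the eigenvalues of the nonbacktracking
   edge matrix [T], counting closed words by the traces of the powers of [T] turns
   the Euler product into [1 / ((1 - x_1 u) ... (1 - x_r u))].  In a (q+1)-regular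
   graph [q] is an eigenvalue and every eigenvalue has modulus at most [q], so that
   the radius of convergence is [1 / q], and an eigenvalue [0 < x < q] gives a pole
   at [1 / x], outside the circle [|u| = 1 / q].  Eigenvalues [x] tending to [q] are
   found on prisms over longer and longer cycles, with [q - 1] parallel rungs: the
   function [cos (2 pi j / n)] is an eigenfunction of the adjacency operator for
   [a = q - 1 + 2 cos (2 pi / n)], whence an eigenvalue [x] of [T] with
   [x + q / x = a]. *)

Set Implicit Arguments.
Unset Strict Implicit.
Unset Printing Implicit Defensive.

Import Order.TTheory GRing.Theory Num.Theory numFieldNormedType.Exports.
Local Open Scope classical_set_scope.
Local Notation cycle := path.cycle.

(** * Words up to rotation, and reduced words *)

Section Powers.
Variable T : eqType.
Implicit Types s w : seq T.

(** No logarithm of the Euler product is taken. The finite product over the classes of length at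
    most [n] is a polynomial that satisfies Newton's identities up to degree [n] for the same power
    sums as the product of the factors [1 - x X] over the eigenvalues. Hence their coefficients
    agree up to degree [n], and a majorant bounds the remaining ones uniformly on a small disc. The
    radius of convergence is a supremum over all expansions at 0, so the uniqueness of power series
    enters; divergence at [1 / q] is then algebraic, since the sum of the series times the
    polynomial is [1]. The bound [1 / q] from below holds for every graph, because there are
    finitely many poles. So only one eigenvalue has to be followed to the limit. The cycle is
    doubled because a rung between the two copies adds one to a degree. Loops on a single cycle
    would add two and fit only one parity of [q]. *)

Definition wpow w k := flatten (nseq k w).

Lemma size_wpow w k : size (wpow w k) = (k * size w)%N.
Proof. by rewrite size_flatten /shape map_nseq sumn_nseq mulnC. Qed.

Lemma wpow_rotate a b k : a ++ wpow (b ++ a) k = wpow (a ++ b) k ++ a.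
Proof.
elim: k => [|k IHk]; first by rewrite /wpow /= cats0.
by rewrite /wpow /= -!/(wpow _ _) -!catA -IHk !catA.
Qed.

Lemma rot_wpow j w k : (j <= size w)%N -> rot j (wpow w k) = wpow (rot j w) k.
Proof.
case: k => [|k] jw; first by rewrite /wpow.
rewrite -{1}(cat_take_drop j w) /rot.
set a := take j w; set b := drop j w; have sa : size a = j by rewrite size_takel.
rewrite /wpow /= -!/(wpow _ _) -!catA drop_size_cat // take_size_cat //.
by rewrite -catA -wpow_rotate.
Qed.

Lemma take_wpow w k : (0 < k)%N -> take (size w) (wpow w k) = w.
Proof. by case: k => // k _; rewrite /wpow /= take_size_cat. Qed.

Lemma nth_rot x0 k s j : (k <= size s)%N -> (j < size s)%N ->
  nth x0 (rot k s) j = nth x0 s ((j + k) %% size s).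
Proof.
move=> ks js; rewrite /rot nth_cat size_drop; case: ltnP => h.
  by rewrite nth_drop addnC modn_small //; lia.
rewrite nth_take; last by lia.
have -> : (j + k = (j - (size s - k)) + size s)%N by lia.
by rewrite modnDr modn_small //; lia.
Qed.

Lemma nth_wpow x0 w k j : (j < k * size w)%N ->
  nth x0 (wpow w k) j = nth x0 w (j %% size w).
Proof.
elim: k j => [|k IHk] j //= jk; rewrite /wpow /= -/(wpow _ _) nth_cat.
case: ltnP => h; first by rewrite modn_small.
rewrite IHk; last by lia.
by rewrite -[in RHS](subnK h) modnDr.
Qed.

Definition primitive_word s := all (fun k => rot k s != s) (iota 1 (size s).-1).

Lemma primitive_wordP s :
  reflect (forall k, (0 < k < size s)%N -> rot k s <> s) (primitive_word s).
Proof.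
apply: (iffP allP) => H k hk; last first.
  by apply/eqP/H; move: hk; rewrite mem_iota; lia.
by apply/eqP/H; rewrite mem_iota; lia.
Qed.

Lemma rot_rot_ex a b s : exists k, rot a (rot b s) = rot k s.
Proof. by rewrite rot_rot_add; eexists. Qed.

(** A rotation by [d] that fixes [s] is a period [d] of its letters modulo the length [n]; by Bezout
    [gcdn d n] is a period too, and it divides [n]. *)
Lemma rot_fixed_root s d : (0 < d <= size s)%N -> rot d s = s ->
  exists2 g, [/\ (0 < g)%N, (g <= d)%N & g %| size s] &
    s = wpow (take g s) (size s %/ g).
Proof.
case: s => [|x0 s0]; first by case/andP=> /leq_trans h /h.
set s := x0 :: s0; move=> /andP[d0 ds] ds_fix; pose n := size s.
have n0 : (0 < n)%N by [].
have step m j : nth x0 s ((j + m * d) %% n) = nth x0 s (j %% n).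
  elim: m j => [|m IHm] j; first by rewrite addn0.
  rewrite mulSn [(d + _)%N]addnC addnA -modnDml -/n.
  have := @nth_rot x0 d s ((j + m * d) %% n) ds (ltn_pmod _ n0).
  by rewrite ds_fix IHm -/n.
(* Here [gcdn d n + a * d = b * n]: a shift by [m * g] followed by [m * a] shifts by [d] is trivial
   modulo [n]. *)
have [a _ /dvdnP[b hb]] := Bezoutr d n0.
pose g := gcdn d n; have g0 : (0 < g)%N by rewrite gcdn_gt0 d0.
have gn : g %| n by exact: dvdn_gcdr.
have gd : (g <= d)%N by apply: dvdn_leq => //; exact: dvdn_gcdl.
have stepg m j : nth x0 s ((j + m * g) %% n) = nth x0 s (j %% n).
  rewrite -(step (m * a)%N) -addnA -mulnA -mulnDr hb mulnA.
  by rewrite -modnDmr modnMl addn0.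
exists g; first by split.
have hs : size (take g s) = g by rewrite size_takel //; apply: dvdn_leq.
apply: (@eq_from_nth _ x0) => [|j jn].
  by rewrite size_wpow hs divnK.
rewrite nth_wpow ?hs; last by rewrite divnK.
rewrite nth_take ?ltn_pmod // -[in LHS](modn_small jn) -/n {1}(divn_eq j g) addnC.
rewrite stepg modn_small //; apply: leq_trans (ltn_pmod _ g0) _.
exact: dvdn_leq.
Qed.

(** The least positive rotation that fixes [s] provides the root. A proper rotation fixing the root
    would fix [s] as well, against minimality. *)
Lemma primitive_word_root s : s <> [::] ->
  exists w k, [/\ (0 < k)%N, w <> [::], primitive_word w & s = wpow w k].
Proof.
move=> s0; have n0 : (0 < size s)%N by case: (s) s0.
have : exists d, (0 < d <= size s)%N && (rot d s == s).
  by exists (size s); rewrite rot_size eqxx n0 leqnn.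
case/ex_minnP => d /andP[hd /eqP ds] dmin.
have [g [g0 gd gn] sE] := rot_fixed_root hd ds.
have gs : (g <= size s)%N by exact: dvdn_leq.
have sg : size (take g s) = g by rewrite size_takel.
exists (take g s), (size s %/ g); split=> //; first by rewrite divn_gt0.
  by move/(congr1 size); rewrite sg /=; lia.
apply/primitive_wordP => k; rewrite sg => /andP[k0 kg] kfix.
have : (d <= k)%N; last by lia.
apply: dmin; rewrite k0 (leq_trans (ltnW kg)) //=.
by rewrite sE rot_wpow ?sg ?kfix // ltnW.
Qed.

Lemma primitive_word_rot k w : primitive_word (rot k w) = primitive_word w.
Proof.
apply/primitive_wordP/primitive_wordP; rewrite ?size_rot => H j hj.
  by move=> jw; apply: (H j hj); rewrite rot_rot jw.
by rewrite rot_rot => /rot_inj; exact: H.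
Qed.

(** Rotation by the length of the shorter root fixes the common power, hence fixes the longer root,
    whose primitivity excludes a proper rotation. *)
Lemma wpow_primitive_inj w w' k k' :
  primitive_word w -> primitive_word w' -> (0 < k)%N -> (0 < k')%N ->
  w <> [::] -> w' <> [::] -> wpow w k = wpow w' k' -> w = w'.
Proof.
wlog ww' : w w' k k' / (size w <= size w')%N.
  move=> H pw_ pw'_ k0 k'0 w0 w'0 e; case: (leqP (size w) (size w')) => h.
    exact: (H w w' k k').
  by apply/esym; apply: (H w' w k' k) => //; exact: ltnW.
move=> _ /primitive_wordP p' k0 k'0 w0 _ e.
have w_gt0 : (0 < size w)%N by case: (w) w0.
have fix_w' : rot (size w) w' = w'.
  rewrite -(take_wpow (rot (size w) w') k'0) -[RHS](take_wpow w' k'0) size_rot.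
  by rewrite -rot_wpow // -e rot_wpow // rot_size.
have sz : size w = size w'.
  case: (ltngtP (size w) (size w')) ww' => [h _|//|-> //].
  by case: (p' (size w)) => //; rewrite w_gt0 h.
by rewrite -(take_wpow w k0) -(take_wpow w' k'0) e sz.
Qed.

Lemma primitive_word_rot_inj w j j' : primitive_word w -> (j < size w)%N -> (j' < size w)%N ->
  rot j w = rot j' w -> j = j'.
Proof.
wlog jj' : j j' / (j <= j')%N.
  move=> H pw_ hj hj' e; case: (leqP j j') => h; first exact: H.
  by apply/esym/H => //; exact: ltnW.
move=> /primitive_wordP p _ hj'.
case: (ltngtP j j') jj' => [h _ e|//|//]; exfalso.
apply: (p (j' - j)%N); first by apply/andP; split; lia.
apply: (@rot_inj j); rewrite e -rotD; last by lia.
by congr rot; lia.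
Qed.

Lemma rot_ltn k w : w <> [::] -> exists2 j, (j < size w)%N & rot k w = rot j w.
Proof.
move=> w0; case: (ltnP k (size w)) => h; first by exists k.
by exists 0%N; [case: (w) w0 | rewrite rot0 rot_oversize].
Qed.

Lemma cycle_wpow (r : rel T) w k : (0 < k)%N -> cycle r (wpow w k) = cycle r w.
Proof.
case: k => // k _; case: w => [|x w].
  by congr cycle; rewrite /wpow; elim: k.
rewrite /wpow /= -/(wpow _ _); elim: k => [|k IHk]; first by rewrite cats0.
rewrite /wpow /= -/(wpow _ _) -cat_rcons rcons_cat cat_path last_rcons.
by rewrite IHk andbb.
Qed.

End Powers.

(** * Free reduction of words in letters with a fixed-point-free inversion *)

Section ReducedWords.
Variables (E : eqType) (i : E -> E).
Hypotheses (iK : involutive i) (i_neq : forall e, i e != e).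
Implicit Types s w p : seq E.

Definition inv_word s := rev (map i s).
Definition nonback : rel E := fun e f => f != i e.
Definition cons_reduce e s :=
  if s is f :: s' then (if f == i e then s' else e :: s) else [:: e].
Definition reduce_onto w s := foldr cons_reduce s w.
Definition reduce w := reduce_onto w [::].

Lemma inv_wordK : involutive inv_word.
Proof.
by move=> s; rewrite /inv_word map_rev revK -map_comp map_id_in // => x _; exact: iK.
Qed.

Lemma inv_word_rcons s e : inv_word (rcons s e) = i e :: inv_word s.
Proof. by rewrite /inv_word map_rcons rev_rcons. Qed.

Lemma inv_word_cons s e : inv_word (e :: s) = rcons (inv_word s) (i e).
Proof. by rewrite /inv_word /= rev_cons. Qed.

Lemma nonback_inv e f : nonback (i f) (i e) = nonback e f.
Proof. by rewrite /nonback iK eq_sym. Qed.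

Lemma sorted_inv_word s : sorted nonback (inv_word s) = sorted nonback s.
Proof.
rewrite /inv_word rev_sorted sorted_map; apply: eq_sorted => e f /=.
by rewrite nonback_inv.
Qed.

Lemma sorted_cons_reduce e s : sorted nonback s -> sorted nonback (cons_reduce e s).
Proof.
case: s => [|f s] //= p; case: ifP => [_|fe]; first exact: path_sorted p.
by rewrite /= /nonback fe.
Qed.

Lemma sorted_reduce_onto w s : sorted nonback s -> sorted nonback (reduce_onto w s).
Proof. by elim: w => //= e w IHw /IHw; exact: sorted_cons_reduce. Qed.

Lemma sorted_reduce w : sorted nonback (reduce w).
Proof. exact: sorted_reduce_onto. Qed.

(** Each letter thus permutes the reduced words. If [s] begins with [e], its being reduced is what
    prevents a second cancellation. *)
Lemma cons_reduceK e s : sorted nonback s -> cons_reduce e (cons_reduce (i e) s) = s.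
Proof.
case: s => [|f s] /=; first by rewrite eqxx.
rewrite iK; case: (eqVneq f e) => [->|fe]; last by rewrite /= eqxx.
by case: s => [|g s] //= /andP[/negbTE ->].
Qed.

Lemma reduce_id s : sorted nonback s -> reduce s = s.
Proof.
elim: s => //= e s IHs p; rewrite /reduce /= -/(reduce s) IHs ?(path_sorted p) //.
by case: s p {IHs} => //= f s /andP[/negbTE ->].
Qed.

Lemma reduce_onto_cat w w' s : reduce_onto (w ++ w') s = reduce_onto w (reduce_onto w' s).
Proof. exact: foldr_cat. Qed.

Lemma size_reduce w : (size (reduce w) <= size w)%N.
Proof.
rewrite /reduce; elim: w => //= e w IHw.
by case: (reduce_onto w [::]) IHw => //= f s; case: ifP => //= _ /ltnW /leqW.
Qed.

(** Mutually inverse first and last letters are stripped in turn. What lies between them is nonempty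
    because [w] is reduced, and a single letter is cyclically reduced because it is not its own
    inverse. *)
Lemma cyclic_decomp w : sorted nonback w -> w <> [::] ->
  exists r s, [/\ w = r ++ s ++ inv_word r, s <> [::] & cycle nonback s].
Proof.
have [n] := ubnP (size w); elim: n w => // n IHn [|e w] //.
case: (lastP w) => [_ _ _|m f].
  by exists [::], [:: e]; rewrite /= /nonback eq_sym i_neq.
case: (eqVneq f (i e)) => [->|fe] sz p _.
  have m0 : m <> [::] by move=> m0; move: p; rewrite m0 /= /nonback eqxx.
  have sm : sorted nonback m.
    by move: p; rewrite /= rcons_path => /andP[/path_sorted].
  have [|r [s [mE s0 sc]]] := IHn m _ sm m0.
    by move: sz; rewrite /= size_rcons; lia.
  by exists (e :: r), s; split; rewrite // inv_word_cons mE -!cats1 /= !catA.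
exists [::], (e :: rcons m f); split; rewrite ?cats0 //.
rewrite [cycle _ _]rcons_path last_rcons (p : path nonback e (rcons m f)).
by rewrite /nonback /= eq_sym (inv_eq iK).
Qed.

Lemma cycle_nonback_sorted s : cycle nonback s -> sorted nonback s.
Proof. by case: s => //= e s; rewrite rcons_path => /andP[]. Qed.

(* If the conjugate [p s p^-1] of a cyclically reduced word is not reduced as it
   is written, then a letter of [p] cancels at one end of [s], which rotates [s]. *)
Lemma conj_rot p s s' : sorted nonback p -> s <> [::] -> cycle nonback s -> cycle nonback s' ->
  reduce (p ++ s ++ inv_word p) = s' -> exists k, s' = rot k s.
Proof.
elim/last_ind: p s => [|p f IHp] s sp s0 cs cs'.
  by rewrite cats0 reduce_id ?cycle_nonback_sorted // => <-; exists 0%N; rewrite rot0.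
have sp' : sorted nonback p by move: sp; rewrite -cats1 => /cat_sorted2[].
have finish k : reduce (rcons p f ++ s ++ inv_word (rcons p f)) =
    reduce (p ++ rot k s ++ inv_word p) ->
    reduce (rcons p f ++ s ++ inv_word (rcons p f)) = s' ->
    exists k, s' = rot k s.
  move=> -> e; have [||j ->] := IHp (rot k s) sp' _ _ cs' e; last exact: rot_rot_ex.
    by move/(congr1 size); rewrite size_rot; case: (s) s0.
  by rewrite rot_cycle.
rewrite inv_word_rcons in finish *; rewrite cat_rcons in finish *.
case: (eqVneq (head f s) (i f)) => [hs|hs].
  case: s s0 cs finish hs => [|e s1] // _ cs finish eE.
  apply: (finish 1%N); rewrite /reduce !reduce_onto_cat; congr reduce_onto.
  rewrite /= in eE; rewrite eE /= drop0 take0 reduce_onto_cat cons_reduceK //.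
  by rewrite !sorted_reduce_onto.
case: (eqVneq (last f s) f) => [ls|ls].
  case/lastP: s s0 cs finish {hs} ls => [|s1 l] // _ cs finish.
  rewrite last_rcons => lf; apply: (finish (size s1)).
  rewrite -cats1 rot_size_cat lf /reduce !reduce_onto_cat; congr reduce_onto.
  by rewrite /= !reduce_onto_cat /= cons_reduceK // sorted_reduce_onto.
have {}hs : path nonback f s.
  move: s0 hs (cycle_nonback_sorted cs); case: (s) => [|e s1] //= _.
  by rewrite /nonback => ->.
rewrite reduce_id; last first.
  rewrite sorted_cat_cons sp cat_path hs /= {1}/nonback.
  rewrite (inj_eq (can_inj iK)) eq_sym ls /=.
  by move: sp; rewrite -sorted_inv_word inv_word_rcons.
(* Without cancellation the result begins with the first letter of [rcons p f] and ends with its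
   inverse, so it is not cyclically reduced. *)
move=> s'E; move: cs'; rewrite -s'E; case: (p) => [|x p1] /=.
  rewrite rcons_path -[s ++ _]cats0 -catA last_cat /=.
  by rewrite /nonback iK eqxx andbF.
rewrite inv_word_cons -rcons_cons -rcons_cat -!rcons_cons -rcons_cat.
by rewrite rcons_path last_rcons /nonback iK eqxx andbF.
Qed.

End ReducedWords.

(** * Graphs of trivial groups and their covering trees *)

Lemma nat_min_eq (A : set nat) n :
  A n -> (forall m, A m -> (n <= m)%N) -> nat_min A = n.
Proof.
move=> An Amin; rewrite /nat_min; case: xgetP => [m _ [Am mmin]|/(_ n)[]]; last by split.
by apply/eqP; rewrite eqn_leq mmin // Amin.
Qed.

Section TrivialGroups.
Variables (V E : finType) (t : E -> V) (i : E -> E).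
Hypotheses (iK : involutive i) (i_neq : forall e, i e <> e).

Definition simple_graph := Graph t iK i_neq.

Hypothesis conn : connected_graph simple_graph.
Variable b : V.

Fact eident1K (e : E) (g : 'I_1) : existT (fun _ : E => 'I_1) (i (i e)) g = existT _ e g.
Proof. by rewrite iK. Qed.

Definition trivial_gog := @GraphOfGroups simple_graph conn b
  (fun _ => 'I_1) (fun _ => 'I_1) (fun _ => id) (fun _ _ _ => erefl) eident1K
  (fun _ => id) (fun _ _ _ => erefl) (fun _ _ _ => id).

Notation X := trivial_gog.
Implicit Types (s w : seq E) (x y : V) (p r : path_group X).

Let i_neqb e : i e != e. Proof. exact/eqP/i_neq. Qed.

Definition pcls s : path_group X := cls (map (@eletter X) s).

Definition edges (w : word X) : seq E :=
  pmap (fun l : letter X => if l is inr e then Some (e : E) else None) w.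

Lemma edges_weq (w : word X) : weq w (map (@eletter X) (edges w)).
Proof.
elim: w => [|[[x g]|e] w IHw]; first exact: weq_refl.
  apply: (weq_cat (w1 := [:: _]) (w1' := [::])) IHw.
  by rewrite (_ : g = 1%g); [exact: weq_one | rewrite [LHS]ord1 [RHS]ord1].
by apply: (weq_cat (w1 := [:: _]) (w1' := [:: _])) IHw; exact: weq_refl.
Qed.

(** Van der Waerden's argument: words act on the set of reduced words and every defining relation
    acts trivially. Applied to the empty word, this gives uniqueness of reduced forms in the path
    group. *)
Lemma reduce_onto_weq (w w' : word X) : weq w w' ->
  forall s, sorted (nonback i) s -> reduce_onto i (edges w) s = reduce_onto i (edges w') s.
Proof.
elim=> //= [v v' _ IH s ss|v v' v'' _ IH _ IH' s ss|
  v1 v1' v2 v2' _ IH1 _ IH2 s ss|e s ss|e _ s ss].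
- by rewrite IH.
- by rewrite IH // IH'.
- by rewrite /edges !pmap_cat !reduce_onto_cat -!/(edges _) IH2 // IH1 // sorted_reduce_onto.
- exact: cons_reduceK.
- exact: cons_reduceK.
Qed.

Lemma edges_eletter s : edges (map (@eletter X) s) = s.
Proof. by elim: s => //= e s ->. Qed.

Lemma pcls_cat s w : pcls (s ++ w) = (pcls s * pcls w)%g.
Proof. by rewrite /pcls map_cat clsM. Qed.

Lemma pcls_nil : pcls [::] = 1%g. Proof. by []. Qed.

Lemma pcls_inv_word s : pcls (inv_word i s) = (pcls s)^-1%g.
Proof. by rewrite -clsV /winv /inv_word /pcls map_rev -!map_comp. Qed.

Lemma pcls_i e : (pcls [:: e] * pcls [:: i e])%g = 1%g.
Proof. exact: (@cls_einv X e). Qed.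

Lemma pcls_reduce s : pcls (reduce i s) = pcls s.
Proof.
elim: s => // e s IHs; rewrite -[e :: s]/([:: e] ++ s) pcls_cat -IHs /reduce /=.
case: (reduce_onto _ _ _) => [|f w] //=; first by rewrite pcls_nil mulg1.
case: eqP => [->|_]; last by rewrite -pcls_cat.
by rewrite -[i e :: w]/([:: i e] ++ w) pcls_cat mulgA pcls_i mul1g.
Qed.

Lemma pclsP s w : pcls s = pcls w <-> reduce i s = reduce i w.
Proof.
split=> [/clsP /reduce_onto_weq /(_ [::] isT)|e]; first by rewrite !edges_eletter.
by rewrite -pcls_reduce e pcls_reduce.
Qed.

Lemma pcls_surj p : exists2 s, sorted (nonback i) s & pcls s = p.
Proof.
have [w <-] := cls_surj p; exists (reduce i (edges w)); first exact: sorted_reduce.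
by rewrite pcls_reduce; apply/clsP/weq_sym/edges_weq.
Qed.

Lemma pcls_wpow s k : pcls (wpow s k) = (pcls s ^+ k)%g.
Proof. by elim: k => // k IHk; rewrite /wpow /= pcls_cat IHk expgS. Qed.

Fixpoint epath x y s :=
  if s is e :: s' then (t (i e) == x) && epath (t e) y s' else x == y.

Lemma epath_cat x y z s w : epath x y s -> epath y z w -> epath x z (s ++ w).
Proof.
elim: s x => [|e s IHs] x /=; first by move/eqP->.
by case/andP=> -> ? ?; exact: IHs.
Qed.

Lemma epath_split x z s w : epath x z (s ++ w) ->
  exists2 y, epath x y s & epath y z w.
Proof.
elim: s x => [|e s IHs] x /=; first by exists x.
by case/andP=> -> /IHs[y ? ?]; exists y.
Qed.

Lemma epath_inv_word x y s : epath x y s -> epath y x (inv_word i s).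
Proof.
elim: s x => [|e s IHs] x /=; first by rewrite eq_sym.
case/andP=> /eqP <- /IHs h; rewrite inv_word_cons -cats1.
by apply: epath_cat h _; rewrite /= iK !eqxx.
Qed.

Lemma epath_end x y z s : epath x y s -> epath x z s -> y = z.
Proof.
elim: s x => [|e s IHs] x /=; first by move=> /eqP-> /eqP.
by case/andP=> _ h /andP[_]; exact: IHs.
Qed.

Lemma epath_reduce x y s : epath x y s -> epath x y (reduce i s).
Proof.
rewrite /reduce; elim: s x => [|e s IHs] x //= /andP[/eqP <- /IHs].
case: (reduce_onto _ _ _) => [|f w] /=; first by rewrite eqxx.
case: (f =P i e) => [->|_] /=; last by rewrite eqxx.
by rewrite iK => /andP[].
Qed.

Lemma pi_setP x y p : pi_set (X := X) x y p <-> exists2 s, epath x y s & pcls s = p.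
Proof.
split=> [[w wp <-]|[s ps <-]].
  exists (edges w); last by apply/clsP/weq_sym/edges_weq.
  elim: w x wp => [|[[z g]|e] w IHw] x /=; first by move=> ->.
    by case=> _ /IHw.
  by case=> [<- /IHw ?]; apply/andP.
exists (map (@eletter X) s) => //.
by elim: s x ps => [|e s IHs] x /=; [move/eqP | case/andP=> /eqP <- /IHs].
Qed.

Lemma pi_set_reduced x y s :
  sorted (nonback i) s -> pi_set (X := X) x y (pcls s) -> epath x y s.
Proof.
move=> ss /pi_setP[w wp /pclsP]; rewrite (reduce_id ss) => <-.
exact: epath_reduce.
Qed.

Lemma pi_set_pcls x y s : epath x y s -> pi_set (X := X) x y (pcls s).
Proof. by move=> ps; apply/pi_setP; exists s. Qed.

Lemma connect_path x y : exists p, pi_set (X := X) x y p.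
Proof.
have [n] := conn x y; elim: n x => [|n IHn] x /=.
  by move=> ->; exists 1%g; exact: pi_set1.
case=> e [<- /IHn[p pp]]; exists (cls [:: @eletter X e] * p)%g.
by apply: pi_setM pp; exact: pi_set_edge.
Qed.

(* The cyclically reduced closed words are the cycles of this relation. *)
Definition adj : rel E := fun e f => (t e == t (i f)) && nonback i e f.

Lemma cycle_adj e s :
  cycle adj (e :: s) = cycle (nonback i) (e :: s) && epath (t (i e)) (t (i e)) (e :: s).
Proof.
rewrite /= eqxx /=.
have H f g : path adj f (rcons s g) =
    path (nonback i) f (rcons s g) && epath (t f) (t (i g)) s.
  elim: s f => [|h s IHs] f /=; first by rewrite !andbT /adj andbC.
  rewrite IHs /adj [t (i h) == _]eq_sym; case: (t f == _); rewrite ?andbF //=.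
  by rewrite andbA.
exact: H.
Qed.

Lemma cycle_adjP s : s <> [::] ->
  reflect (cycle (nonback i) s /\ exists x, epath x x s) (cycle adj s).
Proof.
case: s => // e s _; rewrite cycle_adj; apply: (iffP andP) => [[]|[ce [x]]].
  by split=> //; exists (t (i e)).
by move=> h; split=> //; case/andP: (h) => /eqP xE _; rewrite xE.
Qed.

(** With trivial groups the cosets that make up the covering tree are singletons, so a vertex over
    [x] is just an element of [pi_set b x]. *)
Lemma vsub1 (x : vert X) : @vsub X x = [set 1%g].
Proof.
have H (g : 'I_1) : cls [:: @vletter X x g] = 1%g.
  rewrite -cls1; apply/clsP.
  by rewrite (_ : g = 1%g); [exact: weq_one | rewrite [LHS]ord1 [RHS]ord1].
apply/seteqP; split=> [_ [g _ <-]|_ ->]; first exact: H.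
by exists 1%g.
Qed.

Lemma esub1 (e : edge X) : @esub X e = [set 1%g].
Proof.
have H y (g : 'I_1) : cls [:: @vletter X y g] = 1%g.
  rewrite -cls1; apply/clsP.
  by rewrite (_ : g = 1%g); [exact: weq_one | rewrite [LHS]ord1 [RHS]ord1].
apply/seteqP; split=> [_ [g _ <-]|_ ->]; first exact: H.
by exists 1%g => //; exact: H.
Qed.

Lemma lmul_set1 p q : lmul p [set q] = [set (p * q)%g].
Proof. exact: image_set1. Qed.

Lemma rmul_set1 p q : rmul [set p] q = [set (p * q)%g].
Proof. by rewrite /rmul image_set1. Qed.

Lemma smul_set1 p q : smul [set p] [set q] = [set (p * q)%g].
Proof.
apply/seteqP; split=> [_ [_ [_ [-> -> ->]]]|_ ->] //.
by exists p, q.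
Qed.

Fact tree_vertex_subproof x p : pi_set (X := X) b x p -> tree_vert_pred (x : vert X, [set p]).
Proof. by move=> h; exists p => //=; rewrite vsub1 lmul_set1 mulg1. Qed.

Definition tree_vertex x p (h : pi_set (X := X) b x p) : tree_vert X :=
  exist (@tree_vert_pred X) _ (tree_vertex_subproof h).

Fact tree_arc_subproof e p : pi_set (X := X) b (t (i e)) p ->
  tree_edge_pred (e : edge X, [set p]).
Proof. by move=> h; exists p => //=; rewrite esub1 lmul_set1 mulg1. Qed.

Definition tree_arc e p (h : pi_set (X := X) b (t (i e)) p) : tree_edge X :=
  exist (@tree_edge_pred X) _ (tree_arc_subproof h).

Lemma tree_vertex_inj x y p q (hp : pi_set (X := X) b x p) (hq : pi_set (X := X) b y q) :
  tree_vertex hp = tree_vertex hq <-> x = y /\ p = q.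
Proof.
split=> [[-> /seteqP[/(_ p erefl) ->]]|[xy pq]] //.
by apply: tree_vert_eq => /=; rewrite xy pq.
Qed.

Lemma tree_vertexP (v : tree_vert X) :
  exists x p (h : pi_set (X := X) b x p), v = tree_vertex h.
Proof.
case: v => [[x A] H]; case: (H) => p /= hp AE; exists x, p, hp.
by apply: tree_vert_eq => /=; rewrite AE vsub1 lmul_set1 mulg1.
Qed.

Lemma tree_arcP (v : tree_edge X) :
  exists e p (h : pi_set (X := X) b (t (i e)) p), v = tree_arc h.
Proof.
case: v => [[x A] H]; case: (H) => p /= hp AE; exists x, p, hp.
by apply: tree_edge_eq => /=; rewrite AE esub1 lmul_set1 mulg1.
Qed.

Lemma pi_set_edge1 e p : pi_set (X := X) b (t (i e)) p ->
  pi_set (X := X) b (t e) (p * pcls [:: e])%g.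
Proof. by move=> h; apply: pi_setM h _; exact: (@pi_set_edge X e). Qed.

Lemma tgt_tree_arc e p (h : pi_set (X := X) b (t (i e)) p) :
  tgt (tree_arc h : edge (tree X)) = tree_vertex (pi_set_edge1 h).
Proof.
apply: tree_vert_eq => /=; congr pair.
by rewrite vsub1 rmul_set1 smul_set1 mulg1.
Qed.

Lemma src_tree_arc e p (h : pi_set (X := X) b (t (i e)) p) :
  src (tree_arc h : edge (tree X)) = tree_vertex h.
Proof.
apply: tree_vert_eq => /=; congr pair.
by rewrite vsub1 !rmul_set1 smul_set1 mulg1 -mulgA cls_einv mulg1.
Qed.

Lemma src_tree_arc_eq e p x q
  (h : pi_set (X := X) b (t (i e)) p) (hx : pi_set (X := X) b x q) :
  src (tree_arc h : edge (tree X)) = tree_vertex hx <-> t (i e) = x /\ p = q.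
Proof. by rewrite src_tree_arc tree_vertex_inj. Qed.

Lemma act_tree_vertex (g : pi1 X) x p (h : pi_set (X := X) b x p) :
  act g (tree_vertex h) = tree_vertex (pi_setM (pi1P g) h).
Proof. by apply: tree_vert_eq; rewrite /= lmul_set1. Qed.

(** Crossing a tree edge over [e] multiplies the label of the vertex by [e] on the right. The word
    [s] may be unreduced, so a distance is a minimum over all words of a given class. *)
Lemma walk_treeP n x y p q (hp : pi_set (X := X) b x p) (hq : pi_set (X := X) b y q) :
  walk (G := tree X) n (tree_vertex hp) (tree_vertex hq) <->
  exists s, [/\ size s = n, epath x y s & q = (p * pcls s)%g].
Proof.
elim: n x p hp => [|n IHn] x p hp /=.
  rewrite tree_vertex_inj; split=> [[-> ->]|[s [/size0nil-> /eqP-> ->]]].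
    by exists [::]; rewrite /= eqxx mulg1.
  by rewrite mulg1.
split=> [[f []]|[s []]]; last first.
  case: s => //= e s [sn] /andP[/eqP ex es] qE.
  have hp' : pi_set (X := X) b (t (i e)) p by rewrite ex.
  exists (tree_arc hp'); split; first exact/src_tree_arc_eq.
  rewrite [tree_tgt _](tgt_tree_arc hp'); apply/IHn; exists s; split=> //.
  by rewrite qE -mulgA -pcls_cat.
have [e [p' [hp' ->]]] := tree_arcP f => fs fw.
have [ex pp] := (src_tree_arc_eq hp' hp).1 fs.
have /IHn[s [sn es qE]] :
    walk (G := tree X) n (tree_vertex (pi_set_edge1 hp')) (tree_vertex hq).
  by rewrite -tgt_tree_arc.
exists (e :: s); split=> //=; first by rewrite sn.
  by rewrite ex eqxx.
by rewrite qE -pp -mulgA -pcls_cat.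
Qed.

(** The covering map is bijective on stars: an edge that leaves a given lift of [x] is determined by
    its image. *)
Lemma regular_trivial_gog d : (forall x, #|[pred e | t (i e) == x]| = d) ->
  regular_gog d X.
Proof.
move=> deg v; have [x [p [h ->]]] := tree_vertexP v.
set A := [set e | _].
have inj : {in A &, injective (fun f : tree_edge X => (sval f).1)}.
  move=> f g /set_mem + /set_mem; have [e [p1 [h1 ->]]] := tree_arcP f.
  have [e' [p2 [h2 ->]]] := tree_arcP g; move=> fA gA /= ee.
  have [_ pp] := (src_tree_arc_eq h1 h).1 fA; have [_ pp'] := (src_tree_arc_eq h2 h).1 gA.
  by apply: tree_edge_eq => /=; rewrite ee pp pp'.
have img : [set` [pred e | t (i e) == x]] = (fun f : tree_edge X => (sval f).1) @` A.
  apply/seteqP; split=> [e /= /eqP ex|_ /= [f Af <-]].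
    have h' : pi_set (X := X) b (t (i e)) p by rewrite ex.
    by exists (tree_arc h') => //; apply/src_tree_arc_eq.
  have [e [q [hq fE]]] := tree_arcP f; rewrite fE in Af *.
  have [eE _] := (src_tree_arc_eq hq h).1 Af.
  exact/eqP.
have := inj_card_eq inj; rewrite -img -(deg x) => /card_esym/card_eq_trans; apply.
rewrite cardE; set P := [pred e | _].
apply/pcard_eqP/bijPex; exists (fun e => index e (enum P)); split.
- by move=> e /= Pe; rewrite /= index_mem mem_enum.
- move=> e f /set_mem Pe /set_mem Pf /(congr1 (nth e (enum P))).
  by rewrite !nth_index ?mem_enum.
- move=> k /= kP; have e0 : E by case: (enum P) kP.
  exists (nth e0 (enum P) k); last by rewrite index_uniq ?enum_uniq.
  by have := mem_nth e0 kP; rewrite mem_enum.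
Qed.

End TrivialGroups.

(** * Conjugacy classes and closed nonbacktracking words *)

Lemma nat_min_in (A : set nat) n : A n -> A (nat_min A).
Proof.
move=> An; have exA : exists m, `[< A m >] by exists n; exact/asboolP.
case: (ex_minnP exA) => m /asboolP Am mmin.
by rewrite (nat_min_eq Am) // => k Ak; apply/mmin/asboolP.
Qed.

Section ConjugacyClasses.
Variables (V E : finType) (t : E -> V) (i : E -> E).
Hypotheses (iK : involutive i) (i_neq : forall e, i e <> e).
Hypothesis conn : connected_graph (simple_graph t iK i_neq).
Variable b : V.

Notation X := (trivial_gog conn b).
Notation pcls := (pcls conn b).
Notation epath := (epath t i).
Notation adj := (adj t i).
Notation pi_set := (pi_set (X := X)).
Implicit Types (s w : seq E) (x y : V) (p r : path_group X) (g h : pi1 X).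

Let i_neqb e : i e != e. Proof. exact/eqP/i_neq. Qed.

Lemma pcls_eq1 s : sorted (nonback i) s -> pcls s = 1%g -> s = [::].
Proof. by move=> ss /(pclsP conn b s [::]); rewrite reduce_id. Qed.

(** The closed word [s] starts at some vertex [y], in general not the base vertex; so [r] is a path,
    and the conjugation takes place in the path group rather than in [pi1]. *)
Definition cyc_rep g s := exists y r,
  [/\ pi_set b y r, epath y y s, cycle (nonback i) s, s <> [::] &
      \val g = (r * pcls s * r^-1)%g].

Lemma conj_rot_pcls s s' p : s <> [::] -> cycle (nonback i) s -> cycle (nonback i) s' ->
  pcls s' = (p * pcls s * p^-1)%g -> exists k, s' = rot k s.
Proof.
move=> s0 cs cs'; have [w ws <-] := pcls_surj p.
rewrite -mulgA -(pcls_inv_word conn) -!pcls_cat => /pclsP.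
rewrite (reduce_id (cycle_nonback_sorted cs')) => /esym.
exact: (conj_rot iK).
Qed.

Lemma cyc_rep_rot g g' p s s' : cyc_rep g s -> cyc_rep g' s' ->
  \val g' = (p * \val g * p^-1)%g -> exists k, s' = rot k s.
Proof.
move=> [y [r [_ _ cs s0 ->]]] [y' [r' [_ _ cs' _ ->]]] e.
apply: (@conj_rot_pcls _ _ (r'^-1 * p * r)%g) => //.
apply: (mulgI r'); apply: (mulIg r'^-1%g); rewrite e.
by rewrite !invMg invgK !mulgA mulgV mul1g mulgK.
Qed.

Lemma cyc_rep_exists g : \val g <> 1%g -> exists s, cyc_rep g s.
Proof.
have [w ws wE] := pcls_surj (\val g); rewrite -wE => g1.
have w0 : w <> [::] by move=> w0; apply: g1; rewrite w0.
have wp : epath b b w.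
  apply: (pi_set_reduced (conn := conn) (b := b)) => //.
  by rewrite wE; exact: pi1P.
have [r [s [E1 s0 cs]]] := cyclic_decomp iK i_neqb ws w0.
move: wp; rewrite E1 => /epath_split[y ry /epath_split[z yz /(epath_inv_word iK)]].
rewrite inv_wordK // => rz; have yzE := epath_end ry rz; subst z.
exists s, y, (pcls r); split=> //; first exact: pi_set_pcls.
by rewrite -wE E1 !pcls_cat (pcls_inv_word conn) mulgA.
Qed.

Lemma cyc_rep_neq1 g s : cyc_rep g s -> \val g <> 1%g.
Proof.
move=> [y [r [_ _ cs s0 ->]]] e; apply: s0; apply: pcls_eq1.
  exact: cycle_nonback_sorted.
by apply: (mulgI r); apply: (mulIg r^-1%g); rewrite e mulg1 mulgV.
Qed.

(** The action is free: fixing a vertex labelled [p] means [g * p = p]. *)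
Lemma hyperbolicP g : hyperbolic g <-> \val g <> 1%g.
Proof.
split=> [hg g1|g1 v].
  case: (hg (tree_vertex (pi_set1 (X := X) b))); rewrite act_tree_vertex.
  apply/tree_vertex_inj; split=> //.
  by rewrite mulg1.
have [x [p [hp ->]]] := tree_vertexP v.
rewrite act_tree_vertex => /tree_vertex_inj[_ e]; apply: g1.
by apply: (mulIg p); rewrite mul1g.
Qed.

(** A walk from the vertex labelled [p] to its image spells the class [p^-1 * g * p]. The cyclically
    reduced core of that word is a rotation of [s], so the walk is at least as long as [s]. *)
Lemma cyc_rep_walk g s n v : cyc_rep g s -> walk (G := tree X) n v (Defs.act g v) ->
  (size s <= n)%N.
Proof.
move=> gs; have [x [p [hp ->]]] := tree_vertexP v.
rewrite act_tree_vertex => /walk_treeP[w [<- _ gw]].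
have {}gw : pcls (reduce i w) = (p^-1 * \val g * p)%g.
  by rewrite pcls_reduce; apply: (mulgI p); rewrite -gw !mulgA mulgV mul1g.
apply: leq_trans (size_reduce i w).
have w0 : reduce i w <> [::].
  move=> w0; apply: (cyc_rep_neq1 gs); apply: (mulgI p^-1%g); apply: (mulIg p).
  by rewrite -gw w0 mulg1 mulVg.
have [r [s' [E1 s'0 cs']]] := cyclic_decomp iK i_neqb (sorted_reduce i w) w0.
have [y [r' [_ _ cs s0 gE]]] := gs.
have [k s'E] : exists k, s' = rot k s.
  apply: (@conj_rot_pcls _ _ ((pcls r)^-1 * p^-1 * r')%g) => //.
  apply: (mulgI (pcls r)); apply: (mulIg (pcls r)^-1%g).
  rewrite -(pcls_inv_word conn) -!pcls_cat -catA -E1 gw gE (pcls_inv_word conn).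
  by rewrite !invMg !invgK !mulgA mulgV mul1g mulgK.
rewrite E1 !size_cat s'E size_rot. move: (size s) (size r) (size _) => a c d; lia.
Qed.

Lemma cyc_rep_length g s : cyc_rep g s -> translation_length g = size s.
Proof.
move=> gs; apply: nat_min_eq => [|_ [v _ <-]].
  (* The vertex labelled [r] lies on the axis of [g]: from there [s] itself leads to the image. *)
  have [y [r [hr ps cs s0 gE]]] := gs; exists (tree_vertex hr) => //.
  apply: nat_min_eq => [|m]; last exact: cyc_rep_walk.
  rewrite /= act_tree_vertex; apply/walk_treeP; exists s; split=> //.
  by rewrite gE mulgVK.
have [x [p [hp ->]]] := tree_vertexP v.
(* As [nat_min] of the empty set is 0, some walk must exist before [dist] can be taken as the length
   of one. *)
have : exists n, walk (G := tree X) n (tree_vertex hp) (Defs.act g (tree_vertex hp)).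
  have := pi_setM (pi_setV hp) (pi_setM (pi1P g) hp) => /pi_setP[w wp wE].
  exists (size w); rewrite act_tree_vertex; apply/walk_treeP; exists w; split=> //.
  by rewrite wE mulKVg.
case=> n hn; apply: (cyc_rep_walk gs (v := tree_vertex hp)).
set z := tree_vertex hp in hn *.
exact: (@nat_min_in [set m | walk (G := tree X) m z (Defs.act g z)] n).
Qed.

Lemma cyc_rep_rotate g s k : cyc_rep g s -> cyc_rep g (rot k s).
Proof.
move=> [y [r [hr ps cs s0 gE]]]; move: ps; rewrite -{1}(cat_take_drop k s).
move=> /epath_split[z yz zy]; exists z, (r * pcls (take k s))%g; split.
- by apply: pi_setM hr _; exact: pi_set_pcls.
- exact: epath_cat zy yz.
- by rewrite rot_cycle.
- by move/(congr1 size); rewrite size_rot; case: (s) s0.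
- rewrite gE -{1}(cat_take_drop k s) /rot !pcls_cat !invMg !mulgA.
  by rewrite mulgK.
Qed.

Lemma cyc_repJ g h s : cyc_rep g s -> cyc_rep (g ^ h)%g s.
Proof.
move=> [y [r [hr ps cs s0 gE]]]; exists y, ((\val h)^-1 * r)%g; split=> //.
  by apply: pi_setM hr; apply: pi_setV; exact: pi1P.
have -> : \val (g ^ h)%g = ((\val h)^-1 * (\val g * \val h))%g by [].
by rewrite gE invMg invgK !mulgA.
Qed.

Lemma epath_start x y x' y' s : s <> [::] -> epath x y s -> epath x' y' s -> x = x'.
Proof. by case: s => //= e s _ /andP[/eqP <- _] /andP[/eqP <-]. Qed.

Lemma pi1_of p : pi_set b b p -> {g : pi1 X | \val g = p}.
Proof. by move=> hp; exists (Sub p (introT (asboolP _) hp)); rewrite SubK. Qed.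

(** A nonempty word determines its starting vertex, so the two paths to it have the same end, and
    one followed by the inverse of the other is a loop at the base vertex. *)
Lemma cyc_rep_conj g g' s : cyc_rep g s -> cyc_rep g' s -> exists h, g' = (g ^ h)%g.
Proof.
move=> [y [r [hr ps cs s0 gE]]] [y' [r' [hr' ps' _ _ g'E]]].
have yE := epath_start s0 ps ps'; subst y'.
have [h hE] := pi1_of (pi_setM hr (pi_setV hr')).
exists h; apply: val_inj; rewrite g'E.
have -> : \val (g ^ h)%g = ((\val h)^-1 * (\val g * \val h))%g by [].
by rewrite hE gE invMg invgK !mulgA mulgVK mulgVK.
Qed.

Lemma cyc_rep_ex s : s <> [::] -> cycle adj s -> exists g, cyc_rep g s.
Proof.
move=> s0 /(cycle_adjP t i s0)[cs [x ps]]; have [r hr] := connect_path conn b b x.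
have [g gE] := pi1_of (pi_setM (pi_setM hr (pi_set_pcls conn b ps)) (pi_setV hr)).
by exists g, x, r; split.
Qed.

Lemma cyc_rep_adj g s : cyc_rep g s -> s <> [::] /\ cycle adj s.
Proof.
by move=> [y [r [hr ps cs s0 gE]]]; split=> //; apply/cycle_adjP => //; split; last exists y.
Qed.

Lemma val_expg g n : \val (g ^+ n)%g = (\val g ^+ n)%g.
Proof. by elim: n => // n IHn; rewrite !expgS -IHn. Qed.

Lemma conj_expg p r n : ((r * p * r^-1) ^+ n)%g = (r * p ^+ n * r^-1)%g.
Proof.
elim: n => [|n IHn]; first by rewrite !expg0 mulg1 mulgV.
by rewrite !expgS IHn !mulgA mulgVK.
Qed.

Lemma epath_wpow x s k : epath x x s -> epath x x (wpow s k).
Proof.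
by move=> ps; elim: k => [|k IHk]; [exact: eqxx | exact: epath_cat ps IHk].
Qed.

Lemma cyc_rep_pow g s k : (0 < k)%N -> cyc_rep g s -> cyc_rep (g ^+ k)%g (wpow s k).
Proof.
move=> k0 [y [r [hr ps cs s0 gE]]]; exists y, r; split=> //.
- exact: epath_wpow.
- by rewrite cycle_wpow.
- by move/(congr1 size); rewrite size_wpow; case: (s) s0 => //= ? ? _; lia.
- by rewrite val_expg gE conj_expg pcls_wpow.
Qed.

(** If [s] is a proper power, the element built from its root has a power that is only conjugate to
    [g]; conjugating that element repairs this. Conversely, if [g] is a proper power, the same power
    of the cyclic word of the root is a rotation of [s]. *)
Lemma primitiveP g s : cyc_rep g s -> (primitive g <-> primitive_word s).
Proof.
move=> gs; split=> [pg|ps h m m1 ge].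
  apply/primitive_wordP => k /andP[k0 ks] /rot_fixed_root [|d [d0 dk dn] sE].
    by rewrite k0 ltnW.
  have sd : size (take d s) = d by rewrite size_takel // (leq_trans dk) // ltnW.
  have m1 : (1 < size s %/ d)%N by rewrite ltn_divRL // mul1n (leq_ltn_trans dk).
  have w0 : take d s <> [::] by move/(congr1 size); rewrite sd => d00; rewrite d00 in d0.
  have [h hs] : exists h, cyc_rep h (take d s).
    apply: cyc_rep_ex => //; rewrite -(@cycle_wpow _ _ _ (size s %/ d)) -?sE; last exact: ltnW.
    by have [] := cyc_rep_adj gs.
  have := cyc_rep_pow (ltnW m1) hs; rewrite -sE => /cyc_rep_conj/(_ gs)[h' ge].
  apply: (pg (h ^ h')%g _ m1); rewrite ge; apply: val_inj.
  have conjE f : \val (f ^ h')%g = ((\val h')^-1 * \val f * \val h')%g.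
    by rewrite -mulgA.
  by rewrite val_expg !conjE -{2 4}[\val h']invgK conj_expg val_expg.
have h1 : \val h <> 1%g.
  by move=> h1; apply: (cyc_rep_neq1 gs); rewrite ge val_expg h1 expg1n.
have [w hw] := cyc_rep_exists h1.
have := cyc_rep_pow (ltnW m1) hw; rewrite -ge => gw.
have [k sE] : exists k, s = rot k (wpow w m).
  by apply: (cyc_rep_rot (p := 1%g) gw gs); rewrite mul1g invg1 mulg1.
move: ps; rewrite sE primitive_word_rot => /primitive_wordP/(_ (size w)).
have w0 : (0 < size w)%N by have [] := cyc_rep_adj hw; case: (w).
rewrite size_wpow rot_wpow // rot_size; apply=> //.
by rewrite w0 /=; nia.
Qed.

Definition class_rep (c : prime_class X) s := exists2 g, sval c g & cyc_rep g s.

Lemma class_rep_ex (c : prime_class X) : exists s, class_rep c s.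
Proof.
case: c => c [g [hg pg cE]]; have [s gs] := cyc_rep_exists ((hyperbolicP g).1 hg).
by exists s, g => //=; rewrite cE; exists 1%g => //; rewrite conjg1.
Qed.

Lemma class_repP (c : prime_class X) s : class_rep c s ->
  exists g, [/\ cyc_rep g s, primitive g & sval c = conj_class g].
Proof.
case=> g' cg' gs; case: c cg' => c [g [hg pg cE]] /=; rewrite cE => -[h _ hE].
have gs' : cyc_rep g s.
  have -> : g = (g' ^ h^-1)%g by rewrite -hE conjgK.
  exact: cyc_repJ.
by exists g.
Qed.

Lemma class_rep_length (c : prime_class X) s : class_rep c s -> class_length c = size s.
Proof.
move=> /class_repP[g [gs _ cE]]; rewrite /class_length cE; apply: nat_min_eq.
  exists g; last exact: cyc_rep_length.
  by exists 1%g => //; rewrite conjg1.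
by move=> _ [_ [h _ <-] <-]; rewrite (cyc_rep_length (cyc_repJ h gs)).
Qed.

Lemma class_rep_word (c : prime_class X) s : class_rep c s ->
  [/\ s <> [::], cycle adj s & primitive_word s].
Proof.
move=> /class_repP[g [gs pg _]]; have [s0 cs] := cyc_rep_adj gs; split=> //.
exact/(primitiveP gs).
Qed.

Lemma class_rep_of s : s <> [::] -> cycle adj s -> primitive_word s ->
  exists c, class_rep c s.
Proof.
move=> s0 cs ps; have [g gs] := cyc_rep_ex s0 cs.
have pc : exists g', [/\ hyperbolic g', primitive g' & conj_class g = conj_class g'].
  exists g; split=> //; last exact/(primitiveP gs).
  by apply/hyperbolicP; exact: cyc_rep_neq1 gs.
exists (exist _ (conj_class g) pc), g => //=.
by exists 1%g => //; rewrite conjg1.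
Qed.

Lemma conj_class_eq g h : conj_class (g ^ h)%g = conj_class g.
Proof.
apply/seteqP; split=> [_ [k _ <-]|_ [k _ <-]].
  by exists (h * k)%g => //; rewrite conjgM.
by exists (h^-1 * k)%g => //; rewrite conjgM conjgK.
Qed.

Lemma class_rep_inj (c c' : prime_class X) s : class_rep c s -> class_rep c' s -> c = c'.
Proof.
move=> /class_repP[g [gs _ cE]] /class_repP[g' [gs' _ cE']].
have [h hE] := cyc_rep_conj gs gs'.
have e : sval c = sval c' by rewrite cE cE' hE conj_class_eq.
by case: c c' {cE cE'} e => [c pc] [c' pc'] /= e; exact: eq_exist.
Qed.

Lemma class_rep_uniq (c : prime_class X) s s' : class_rep c s -> class_rep c s' ->
  exists k, s' = rot k s.
Proof.
move=> /class_repP[g [gs _ cE]] [g' + gs']; rewrite cE => -[h _ g'E].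
apply: (cyc_rep_rot (p := (\val h)^-1%g) gs gs').
by rewrite -g'E invgK -mulgA.
Qed.

Lemma class_rep_rot (c : prime_class X) s k : class_rep c s -> class_rep c (rot k s).
Proof. by case=> g cg gs; exists g => //; exact: cyc_rep_rotate. Qed.

Definition class_word (c : prime_class X) : seq E := xget [::] (class_rep c).

Lemma class_wordP (c : prime_class X) : class_rep c (class_word c).
Proof. by have [s cs] := class_rep_ex c; exact: (xgetPex [::] (ex_intro _ s cs)). Qed.

Lemma size_class_word (c : prime_class X) : size (class_word c) = class_length c.
Proof. by rewrite (class_rep_length (class_wordP c)). Qed.

Lemma class_length_gt0 (c : prime_class X) : (0 < class_length c)%N.
Proof.
rewrite -size_class_word; have [] := class_rep_word (class_wordP c).
by case: class_word.
Qed.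

Lemma finite_short_classes n : finite_set [set c : prime_class X | (class_length c <= n)%N].
Proof.
pose f (u : {k : 'I_n.+1 & k.-tuple E}) : seq E := tagged u.
have -> : [set c : prime_class X | (class_length c <= n)%N] =
    class_word @^-1` (range f).
  apply/seteqP; split=> c /=; rewrite -size_class_word.
    move=> cn; pose k : 'I_n.+1 := Ordinal (cn : (_ < n.+1)%N).
    by exists (Tagged (fun k : 'I_n.+1 => k.-tuple E) (i := k) (in_tuple (class_word c))).
  by case=> -[k u] _ /= <-; rewrite size_tuple -ltnS.
apply: finite_preimage; last exact/finite_image/finite_finset.
move=> c c' _ _ e; apply: class_rep_inj (class_wordP c) _; rewrite e.
exact: class_wordP.
Qed.

Definition short_classes n : {fset prime_class X} :=
  fset_set [set c : prime_class X | (class_length c <= n)%N].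

Lemma in_short_classes n (c : prime_class X) :
  (c \in short_classes n) = (class_length c <= n)%N.
Proof.
rewrite in_fset_set; last exact: finite_short_classes.
by apply/idP/idP => [/set_mem|h]; last exact/mem_set.
Qed.

(* Each closed word is, in a unique way, a power of a rotation of the chosen
   representative of a prime class. *)
Lemma count_closed_words n : (0 < n)%N ->
  (\sum_(c <- short_classes n | (class_length c %| n)%N) class_length c)%N =
  #|[pred u : n.-tuple E | cycle adj u]|.
Proof.
move=> n0; pose L := [seq wpow (rot j (class_word c)) (n %/ class_length c) |
  c <- [seq c <- short_classes n | (class_length c %| n)%N], j <- iota 0 (class_length c)].
have -> : (\sum_(c <- short_classes n | (class_length c %| n)%N) class_length c)%N = size L.
  rewrite size_allpairs_dep sumnE big_map big_filter.
  by apply: eq_bigr => c _; rewrite size_iota.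
have quot (c : prime_class X) : (class_length c %| n)%N -> (0 < n %/ class_length c)%N.
  by move=> cn; rewrite divn_gt0; [exact: dvdn_leq | exact: class_length_gt0].
have rot_rep (c : prime_class X) j : class_rep c (rot j (class_word c)).
  by apply: class_rep_rot; exact: class_wordP.
rewrite cardE -(size_map val); apply/perm_size/uniq_perm.
- apply: allpairs_uniq_dep; first by rewrite filter_uniq // fset_uniq.
    by move=> c _; exact: iota_uniq.
  move=> _ _ /allpairsPdep[c [j [+ + ->]]] /allpairsPdep[c' [j' [+ + ->]]] /=.
  rewrite !mem_filter !mem_iota => /andP[cn _] jc /andP[cn' _] jc' e.
  have [w0 _ pr] := class_rep_word (rot_rep c j).
  have [w0' _ pr'] := class_rep_word (rot_rep c' j').
  have e' := wpow_primitive_inj pr pr' (quot _ cn) (quot _ cn') w0 w0' e.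
  have cc' : c = c' by apply: class_rep_inj (rot_rep c j) _; rewrite e'.
  subst c'; congr Tagged; have [_ _ prw] := class_rep_word (class_wordP c).
  by apply: (primitive_word_rot_inj prw); rewrite ?size_class_word.
- by rewrite map_inj_uniq ?enum_uniq //; exact: val_inj.
move=> s; apply/allpairsPdep/mapP => [[c [j [+ + ->]]]|[u + ->]].
  rewrite mem_filter mem_iota => /andP[cn _] jc.
  have sz : size (wpow (rot j (class_word c)) (n %/ class_length c)) = n.
    by rewrite size_wpow size_rot size_class_word divnK.
  exists (tcast sz (in_tuple (wpow (rot j (class_word c)) (n %/ class_length c)))).
    rewrite mem_enum inE /= val_tcast /= cycle_wpow ?quot //.
    by have [] := class_rep_word (rot_rep c j).
  exact/esym/val_tcast.
rewrite mem_enum inE /= => cu.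
have u0 : val u <> [::] by move/(congr1 size); rewrite size_tuple => n00; rewrite n00 in n0.
have [w [k [k0 w0 pw_ uE]]] := primitive_word_root u0.
have cw : cycle adj w by rewrite -(cycle_wpow _ _ k0) -uE.
have [c cR] := class_rep_of w0 cw pw_.
have [j wE] := class_rep_uniq (class_wordP c) cR.
have [cw0 _ _] := class_rep_word (class_wordP c).
have [j' jc jE] := rot_ltn j cw0.
have nE : n = (k * class_length c)%N.
  by rewrite -(size_tuple u) [tval u]uE size_wpow (class_rep_length cR).
have cn : (class_length c %| n)%N by rewrite nE dvdn_mull.
exists c, j'; split.
- rewrite mem_filter cn in_short_classes; exact: dvdn_leq.
- by rewrite mem_iota /= add0n -size_class_word.
- rewrite [LHS]uE -jE -wE; congr wpow.
  by rewrite nE mulnK // class_length_gt0.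
Qed.

End ConjugacyClasses.

Local Open Scope ring_scope.

(** * Newton's identities and the Euler product *)

Section Newton.
Variable F : numFieldType.
Implicit Types (P Q : {poly F}) (s : nat -> F).

(** Newton's identities involve only power sums of positive index, so [s 0] is discarded. *)
Definition ptrunc n s : {poly F} := \poly_(k < n.+1) (if k == 0%N then 0 else s k).

(* [Q] satisfies Newton's identities up to degree [n] for the power sums [s],
   that is, [-X Q'/Q] agrees with the generating series of [s]. *)
Definition newton n s Q := forall j, (j <= n)%N -> ('X * Q^`() + ptrunc n s * Q)`_j = 0.

Lemma low_coefM n P Q : (forall j, (j <= n)%N -> P`_j = 0) ->
  forall j, (j <= n)%N -> (P * Q)`_j = 0.
Proof.
move=> P0 j jn; rewrite coefM big1 // => k _; rewrite P0 ?mul0r //.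
by apply: leq_trans jn; rewrite -ltnS.
Qed.

(** The logarithmic derivative turns products into sums. *)
Lemma newtonM n s1 s2 Q1 Q2 : newton n s1 Q1 -> newton n s2 Q2 ->
  newton n (fun k => s1 k + s2 k) (Q1 * Q2).
Proof.
move=> h1 h2 j jn.
have -> : ptrunc n (fun k => s1 k + s2 k) = ptrunc n s1 + ptrunc n s2.
  apply/polyP => k; rewrite coefD !coef_poly.
  by case: (k < _)%N; case: (k == _); rewrite ?addr0.
have -> : 'X * (Q1 * Q2)^`() + (ptrunc n s1 + ptrunc n s2) * (Q1 * Q2) =
    ('X * Q1^`() + ptrunc n s1 * Q1) * Q2 + ('X * Q2^`() + ptrunc n s2 * Q2) * Q1.
  by rewrite derivM; ring.
by rewrite coefD; rewrite (low_coefM Q2 h1 jn) (low_coefM Q1 h2 jn) addr0.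
Qed.

Lemma newton1 n : newton n (fun=> 0) 1.
Proof.
move=> j _; rewrite derivC mulr0 add0r mulr1 coef_poly.
by case: ifP => // _; case: ifP.
Qed.

Lemma newton_ext n s s' Q : (forall j, (0 < j <= n)%N -> s j = s' j) ->
  newton n s Q -> newton n s' Q.
Proof.
move=> ss h; suff -> : newton n s' Q = newton n s Q by [].
rewrite /newton; suff -> : ptrunc n s' = ptrunc n s by [].
apply/polyP => k; rewrite !coef_poly; case: ltnP => // kn.
by case: eqP => // k0; rewrite ss //; lia.
Qed.

(** For [Q = 1 - m X^k] the series [-X Q'/Q] is [k m X^k / (1 - m X^k)], the sum of [k m^r X^(k r)]
    over [r >= 1]. The case [m = 1] serves the prime classes, the case [k = 1] the eigenvalues. *)
Lemma newton_factor n m (k : nat) : (0 < k)%N ->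
  newton n (fun j => if (k %| j)%N then k%:R * m ^+ (j %/ k) else 0) (1 - m *: 'X^k).
Proof.
move=> k0 j jn; set s := fun j => _.
have sE i : (i <= n)%N -> (ptrunc n s)`_i = if (i == 0)%N then 0 else s i.
  by move=> ni; rewrite coef_poly ltnS ni.
rewrite derivB derivC derivZ derivXn mulrBr mulr0 sub0r mulrBr mulr1.
rewrite -!scalerAr coefD coefN coefB !coefZ coefMXn sE //.
rewrite coefXM coefMn coefXn.
case: (eqVneq j 0%N) => [->|j0]; first by rewrite k0 mulr0 subr0 oppr0 addr0.
have jk : (j.-1 == k.-1) = (j == k) by apply/eqP/eqP; lia.
rewrite jk; case: (ltngtP j k) => [jk'|kj|->].
- rewrite mul0rn !mulr0 subr0 oppr0 add0r /s; case: ifP => // /dvdn_leq.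
  by rewrite lt0n j0 leqNgt jk' => /(_ isT).
- rewrite mul0rn mulr0 oppr0 add0r sE; last by apply: leq_trans jn; exact: leq_subr.
  rewrite subn_eq0 leqNgt kj /= /s dvdn_subl ?(ltnW kj) //.
  case: (boolP (k %| j)%N) => dv; last by rewrite mulr0 subr0.
  have -> : (j %/ k = ((j - k) %/ k).+1)%N.
    by rewrite -{1}(subnK (ltnW kj)) divnDr ?dvdnn // divnn k0 addn1.
  by rewrite exprS mulrCA subrr.
- rewrite subnn sE // mulr0 subr0 /s dvdnn divnn k0 expr1 mulr1n.
  by rewrite [_ * m]mulrC addNr.
Qed.

(** In degree [j] the identity expresses [j] times the [j]-th coefficient through lower ones; in
    characteristic zero the constant term then determines the rest. *)
Lemma newton_uniq n s P Q : newton n s P -> newton n s Q -> P`_0 = Q`_0 ->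
  forall j, (j <= n)%N -> P`_j = Q`_j.
Proof.
move=> hP hQ e0.
suff H j : (j <= n)%N -> (P - Q)`_j = 0.
  by move=> j /H /eqP; rewrite coefB subr_eq0 => /eqP.
have hD i : (i <= n)%N -> ('X * (P - Q)^`() + ptrunc n s * (P - Q))`_i = 0.
  move=> ni; have -> : 'X * (P - Q)^`() + ptrunc n s * (P - Q) =
      ('X * P^`() + ptrunc n s * P) - ('X * Q^`() + ptrunc n s * Q).
    by rewrite derivB; ring.
  by rewrite coefB hP // hQ // subrr.
have [m] := ubnP j; elim: m j => // m IHm [|j] /ltnSE jm jn.
  by rewrite coefB e0 subrr.
move: hD IHm; set D := P - Q => hD IHm.
have := hD _ jn; rewrite coefD coefXM /= coef_deriv coefM big1 ?addr0.
  by move/eqP; rewrite mulrn_eq0 /= => /eqP.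
case=> k kj _ /=; case: (eqVneq k 0%N) => [->|k0]; first by rewrite coef_poly /= mul0r.
by rewrite IHm ?mulr0 //; lia.
Qed.

End Newton.

Section ProductBounds.
Variable F : numFieldType.

(** An elementary substitute for the exponential bound. The induction closes because [1 + 2 (x + S)
    - (1 + x) (1 + 2 S) = x (1 - 2 S)], which is nonnegative while [S <= 1 / 2]. *)
Lemma prod1D_bound (T : Type) (s : seq T) (x : T -> F) :
  (forall c, 0 <= x c) -> \sum_(c <- s) x c <= 2^-1 ->
  1 <= \prod_(c <- s) (1 + x c) <= 1 + 2 * \sum_(c <- s) x c.
Proof.
move=> x0; elim: s => [|c s IHs]; first by rewrite !big_nil mulr0 addr0 lexx.
rewrite !big_cons => le2; set S := \sum_(_ <- _) _ in le2 IHs *.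
have S0 : 0 <= S by apply: sumr_ge0.
have {IHs} /andP[IH1 IH2] := IHs (le_trans (ler_wpDl (x0 c) (lexx S)) le2).
have xc := x0 c.
apply/andP; split; first by rewrite (le_trans IH1) // ler_peMl ?(le_trans ler01) ?lerDl.
apply: le_trans (ler_wpM2l _ IH2) _; first by rewrite addr_ge0.
rewrite -subr_ge0.
have -> : 1 + 2 * (x c + S) - (1 + x c) * (1 + 2 * S) = x c * (2 * (2^-1 - S)).
  by field.
apply: mulr_ge0 => //; apply: mulr_ge0 => //; rewrite subr_ge0.
by apply: le_trans le2; rewrite lerDr.
Qed.

Lemma prod1B_bound (T : Type) (s : seq T) (y : T -> F) :
  `|\prod_(c <- s) (1 - y c)| <= \prod_(c <- s) (1 + `|y c|) /\
  `|\prod_(c <- s) (1 - y c) - 1| <= \prod_(c <- s) (1 + `|y c|) - 1.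
Proof.
elim: s => [|c s [IH1 IH2]]; first by rewrite !big_nil subrr normr0 normr1 lexx.
rewrite !big_cons; set p := \prod_(_ <- _) (1 - _) in IH1 IH2 *.
set m := \prod_(_ <- _) (1 + _) in IH1 IH2 *; split.
  rewrite normrM ler_pM //; apply: le_trans (ler_normB _ _) _.
  by rewrite normr1.
have -> : (1 - y c) * p - 1 = (p - 1) - y c * p by ring.
apply: le_trans (ler_normB _ _) _; rewrite normrM.
have -> : (1 + `|y c|) * m - 1 = (m - 1) + `|y c| * m by ring.
by rewrite lerD // ler_wpM2l.
Qed.

Lemma one_plus_double (x : F) : x <= 2^-1 -> 1 + 2 * x <= 2.
Proof. by move=> x2; rewrite -[leRHS]/(1 + 1) lerD2l -ler_pdivlMl // mulr1. Qed.

Lemma sum_pow_quarter n : \sum_(1 <= j < n.+1) (4^-1 ^+ j : F) <= 2^-1.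
Proof.
(* The added term makes the bound inductive: [1 / 4 + 1 / 8 <= 1 / 2]. *)
suff : \sum_(1 <= j < n.+1) (4^-1 ^+ j : F) + 2^-1 * 4^-1 ^+ n <= 2^-1.
  by apply: le_trans; rewrite lerDl mulr_ge0 ?exprn_ge0 ?invr_ge0.
elim: n => [|n IHn]; first by rewrite big_geq // add0r mulr1.
rewrite big_nat_recr //=; apply: le_trans IHn; rewrite -addrA lerD2l.
have : 0 <= (4^-1 : F) ^+ n by rewrite exprn_ge0 ?invr_ge0.
rewrite exprS; move: (4^-1 ^+ n) => e e0; rewrite -subr_ge0.
have -> : 2^-1 * e - (4^-1 * e + 2^-1 * (4^-1 * e)) = 8^-1 * e by field.
by rewrite mulr_ge0 ?invr_ge0.
Qed.

End ProductBounds.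

(** * Comparison of finite Euler products with the polynomial of the eigenvalues *)

Section EulerProduct.
Variables (F : numFieldType) (I : choiceType) (l : I -> nat).
Hypothesis l_gt0 : forall c, (0 < l c)%N.
Variable P : nat -> {fset I}.
Hypothesis inP : forall n c, (c \in P n) = (l c <= n)%N.
Variables (lam : seq F) (M : nat).
Hypothesis M_gt0 : (0 < M)%N.
Let N n := (\sum_(c <- P n | l c %| n) l c)%N.
Hypothesis N_lam : forall n, (0 < n)%N -> (N n)%:R = \sum_(x <- lam) x ^+ n.
Hypothesis N_le : forall n, (0 < n)%N -> (N n <= M ^ n)%N.

Definition euler_poly : {poly F} := \prod_(x <- lam) (1 - x *: 'X).
Definition partial_product n : {poly F} := \prod_(c <- P n) (1 - 'X^(l c)).

Lemma newton_prod (T : Type) n (s : seq T) (f : T -> nat -> F) (Q : T -> {poly F}) :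
  (forall c, newton n (f c) (Q c)) ->
  newton n (fun j => \sum_(c <- s) f c j) (\prod_(c <- s) Q c).
Proof.
move=> h; elim: s => [|c s IHs].
  rewrite big_nil; apply: (newton_ext _ (@newton1 _ n)) => j _; by rewrite big_nil.
rewrite big_cons; apply: (newton_ext _ (newtonM (h c) IHs)) => j _.
by rewrite big_cons.
Qed.

(** A class whose length divides [j], for [0 < j <= n], already lies in [P n], so the partial
    product has the full counts [N j] as power sums up to degree [n]. *)
Lemma coef_partial_product n j : (j <= n)%N -> (partial_product n)`_j = euler_poly`_j.
Proof.
pose s j := \sum_(x <- lam) x ^+ j : F.
apply: (@newton_uniq _ n s).
- have := newton_prod (P n) (fun c => @newton_factor F n 1 _ (l_gt0 c)).
  under eq_bigr do rewrite scale1r; move/newton_ext; apply => {}j /andP[j0 jn].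
  rewrite /s -N_lam // /N natr_sum.
  transitivity (\sum_(c <- P n) if (l c %| j)%N then (l c)%:R else 0 : F).
    by apply: eq_bigr => c _; rewrite expr1n mulr1.
  rewrite -big_mkcond -[LHS]big_filter -[RHS]big_filter; apply: perm_big.
  apply: uniq_perm; rewrite ?filter_uniq ?fset_uniq // => c.
  rewrite !mem_filter !inP; case: (boolP (_ %| _)%N) => //= /(dvdn_leq j0) lj.
  by rewrite lj (leq_trans lj).
- have := newton_prod lam (fun x => @newton_factor F n x 1%N isT).
  move/newton_ext; apply => {}j _; apply: eq_bigr => x _.
  by rewrite dvd1n divn1 mul1r.
rewrite -!horner_coef0 !horner_prod !big1 // => x _.
  by rewrite !hornerE /= ?mulr0 ?subr0.
by rewrite !hornerE /= expr0n eqn0Ngt l_gt0 ?subr0.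
Qed.

(* The [n]-th coefficient of the sum of [u ^ l c] over the classes is at most
   [M ^ n], so that the sum is at most [1 / 2] for [u = 1 / (4 M)]. *)
Definition euler_radius : F := (4 * M)%:R^-1.

Lemma euler_radius_gt0 : 0 < euler_radius.
Proof. by rewrite invr_gt0 ltr0n muln_gt0. Qed.
Let euler_radius_ge0 := ltW euler_radius_gt0.

Lemma sum_euler_radius (A : {fset I}) : \sum_(c <- A) euler_radius ^+ l c <= 2^-1.
Proof.
pose n := \max_(c <- A) l c.
have AP : {subset A <= P n}.
  by move=> c cA; rewrite inP; exact: (@leq_bigmax_seq _ _ (fun=> true)).
have le1 : \sum_(c <- A) euler_radius ^+ l c <= \sum_(c <- P n) euler_radius ^+ l c.
  rewrite [leRHS](bigID (fun c => c \in A)) /= -[leLHS]addr0 lerD //; last first.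
    by apply: sumr_ge0 => c _; exact: exprn_ge0.
  rewrite -[leRHS]big_filter le_eqVlt; apply/orP; left; apply/eqP.
  apply/perm_big/uniq_perm; rewrite ?filter_uniq ?fset_uniq // => c.
  by rewrite mem_filter; case: (boolP (c \in A)) => // /AP ->.
apply: le_trans le1 _; apply: le_trans (sum_pow_quarter F n).
have -> : \sum_(c <- P n) euler_radius ^+ l c =
    \sum_(1 <= j < n.+1) \sum_(c <- P n | l c == j) euler_radius ^+ j.
  rewrite (exchange_big_dep xpredT) //=; apply: eq_big_seq => c cP.
  rewrite big_mkcond (bigD1_seq (l c)) ?iota_uniq //=; last first.
    by rewrite mem_index_iota l_gt0 ltnS -inP.
  by rewrite eqxx big1 ?addr0 // => j; rewrite eq_sym => /negbTE ->.
rewrite !big_nat; apply: ler_sum => j /andP[j0 jn].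
have -> : \sum_(c <- P n | l c == j) euler_radius ^+ j =
    (\sum_(c <- P n | l c == j) 1)%N%:R * euler_radius ^+ j.
  by rewrite natr_sum mulr_suml; apply: eq_bigr => c _; rewrite mul1r.
have -> : (4^-1 : F) ^+ j = (M ^ j)%N%:R * euler_radius ^+ j.
  rewrite /euler_radius natrM invfM exprMn natrX mulrCA -exprMn divff ?expr1n ?mulr1 //.
  by rewrite pnatr_eq0 -lt0n.
rewrite ler_wpM2r ?exprn_ge0 // ler_nat; apply: leq_trans (N_le j0).
rewrite /N [leqRHS](bigID (fun c => l c == j)) /=; apply: leq_trans (leq_addr _ _).
have -> : (\sum_(c <- P j | (l c %| j) && (l c == j)) l c =
   \sum_(c <- P n | l c == j) l c)%N.
  rewrite -[LHS]big_filter -[RHS]big_filter; apply: perm_big.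
  apply: uniq_perm; rewrite ?filter_uniq ?fset_uniq // => c.
  rewrite !mem_filter !inP; case: (eqVneq (l c) j) => [->|_]; last by rewrite andbF.
  by rewrite dvdnn leqnn -ltnS jn.
by apply: leq_sum => c _.
Qed.

(** On the left is a truncated weighted l1-norm of coefficients. A factor [1 - X^l] multiplies it by
    at most [1 + euler_radius ^+ l], and the truncation does no harm because [X^l] only raises
    degrees. *)
Lemma majorant_prod (s : seq I) m :
  \sum_(k < m) `|(\prod_(c <- s) (1 - 'X^(l c) : {poly F}))`_k| * euler_radius ^+ k <=
  \prod_(c <- s) (1 + euler_radius ^+ l c).
Proof.
elim: s => [|c s IHs].
  rewrite !big_nil; case: m => [|m]; first by rewrite big_ord0.
  rewrite big_ord_recl big1 => [|k _]; last by rewrite coef1 normr0 mul0r.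
  by rewrite coef1 normr1 mulr1 addr0.
rewrite !big_cons; set p := \prod_(_ <- _) (1 - _) in IHs *.
apply: le_trans (ler_wpM2l _ IHs); last by rewrite addr_ge0 ?exprn_ge0.
rewrite [leRHS]mulrDl mul1r.
have -> : (1 - 'X^(l c)) * p = p - p * 'X^(l c) by rewrite mulrBl mul1r mulrC.
apply: (@le_trans _ _ (\sum_(k < m) `|p`_k| * euler_radius ^+ k +
    \sum_(k < m) `|(p * 'X^(l c))`_k| * euler_radius ^+ k)).
  rewrite -big_split /=; apply: ler_sum => k _; rewrite coefB -mulrDl.
  by rewrite ler_wpM2r ?exprn_ge0 // ler_normB.
rewrite lerD2l; case: (leqP m (l c)) => ml.
  rewrite big1 => [|k _]; last first.
    by rewrite coefMXn (leq_trans (ltn_ord k) ml) normr0 mul0r.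
  rewrite mulr_ge0 ?exprn_ge0 // sumr_ge0 // => k _.
  by rewrite mulr_ge0 ?exprn_ge0.
have mE : (m = l c + (m - l c))%N by rewrite subnKC // ltnW.
rewrite [in leLHS]mE big_split_ord /= big1 ?add0r => [|k _]; last first.
  by rewrite coefMXn ltn_ord normr0 mul0r.
rewrite mulr_sumr.
rewrite (eq_bigr (fun k : 'I_(m - l c) =>
  euler_radius ^+ l c * (`|p`_k| * euler_radius ^+ k))).
  rewrite [in leRHS](_ : m = (m - l c) + l c)%N; last by rewrite subnK // ltnW.
  rewrite [leRHS]big_split_ord /= lerDl sumr_ge0 // => k _.
  by rewrite !mulr_ge0 ?exprn_ge0.
move=> k _; rewrite coefMXn ltnNge leq_addr /= addKn exprD.
by rewrite mulrCA.
Qed.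

Lemma coef_bound n m : \sum_(k < m) `|(partial_product n)`_k| * euler_radius ^+ k <= 2.
Proof.
apply: le_trans (majorant_prod _ _) _.
have /andP[_ h] :=
  prod1D_bound (fun c => exprn_ge0 (l c) euler_radius_ge0) (sum_euler_radius (P n)).
by apply: le_trans h _; apply: one_plus_double; exact: sum_euler_radius.
Qed.

Lemma horner_partial_product n u : (partial_product n).[u] = \prod_(c <- P n) (1 - u ^+ l c).
Proof. by rewrite horner_prod; apply: eq_bigr => c _; rewrite !hornerE. Qed.

Lemma size_euler_poly : (size euler_poly <= (size lam).+1)%N.
Proof.
rewrite /euler_poly; elim: (lam) => [|x s IHs]; first by rewrite big_nil size_poly1.
rewrite big_cons; apply: leq_trans (size_polyMleq _ _) _.
have : (size (1 - x *: 'X : {poly F})%R <= 2)%N.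
  rewrite (leq_trans (size_polyD _ _)) // geq_max size_poly1 /= size_polyN.
  by rewrite (leq_trans (size_scale_leq _ _)) // size_polyX.
by move=> h; rewrite -subn1 leq_subLR; exact: (leq_add h IHs).
Qed.

(** Up to degree [n] the coefficients agree, and beyond it only the partial product has any. Halving
    the radius gains [2^-(n+1)] on those terms, against the bound [2] of [coef_bound]. *)
Lemma partial_product_tail n u : (size lam <= n)%N -> `|u| <= euler_radius / 2 ->
  `|(partial_product n).[u] - euler_poly.[u]| <= 2^-1 ^+ n.
Proof.
move=> ln ur; pose m := maxn (size (partial_product n)) n.+1.
rewrite (horner_coef_wide _ (leq_maxl _ _ : _ <= m)%N).
rewrite (@horner_coef_wide _ m euler_poly); last first.
  by apply: leq_trans size_euler_poly _; rewrite (leq_trans _ (leq_maxr _ _)).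
rewrite -sumrB; apply: le_trans (ler_norm_sum _ _ _) _.
apply: (@le_trans _ _
  (\sum_(k < m) (`|(partial_product n)`_k| * euler_radius ^+ k) * 2^-1 ^+ n.+1)).
  apply: ler_sum => k _; case: (leqP k n) => kn.
    by rewrite coef_partial_product // subrr normr0 !mulr_ge0 ?exprn_ge0 ?invr_ge0.
  rewrite [euler_poly`_k]nth_default ?mul0r ?subr0; last first.
    by apply: leq_trans size_euler_poly _; rewrite (leq_trans _ kn).
  rewrite normrM -mulrA ler_wpM2l // normrX.
  apply: le_trans (_ : (euler_radius / 2) ^+ k <= _).
    by rewrite lerXn2r ?nnegrE ?divr_ge0.
  rewrite exprMn ler_wpM2l ?exprn_ge0 // ler_wiXn2l ?invr_ge0 //.
  by rewrite invf_le1 ?ler1n.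
rewrite -mulr_suml exprS mulrA -[leRHS]mul1r ler_wpM2r ?exprn_ge0 ?invr_ge0 //.
by rewrite ler_pdivrMr // mul1r coef_bound.
Qed.

(** The factors outside [P n] have length above [n], so their product is within [2^-n] of [1]. It
    multiplies a partial product of modulus at most [2], itself within [2^-n] of the polynomial;
    whence the constant [3]. *)
Lemma euler_product_tail n u (A : {fset I}) : (size lam <= n)%N -> `|u| <= euler_radius / 2 ->
  {subset P n <= A} ->
  `|\prod_(c <- A) (1 - u ^+ l c) - euler_poly.[u]| <= 3 * 2^-1 ^+ n.
Proof.
move=> ln ur PA; rewrite (bigID (fun c => c \in P n)) /=.
have -> : \prod_(c <- A | c \in P n) (1 - u ^+ l c) = (partial_product n).[u].
  rewrite horner_partial_product -big_filter; apply/perm_big/uniq_perm;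
    rewrite ?filter_uniq ?fset_uniq // => c.
  by rewrite mem_filter; case: (boolP (c \in P n)) => // /PA ->.
rewrite -big_filter; set X := (partial_product n).[u]; set B := [seq _ <- _ | _].
have u_le c : `|u ^+ l c| <= 2^-1 ^+ l c * euler_radius ^+ l c.
  by rewrite -exprMn normrX lerXn2r ?nnegrE ?mulr_ge0 ?invr_ge0 // mulrC.
have half1 k : (2^-1 : F) ^+ k <= 1.
  by rewrite exprn_ile1 ?invr_ge0 // invf_le1 ?ler1n.
have u_le1 c : `|u ^+ l c| <= euler_radius ^+ l c.
  by apply: le_trans (u_le c) _; rewrite ler_piMl ?exprn_ge0.
have sumB : \sum_(c <- B) `|u ^+ l c| <= 2^-1 ^+ n * 2^-1.
  apply: le_trans (ler_wpM2l _ (sum_euler_radius A)); last by rewrite exprn_ge0 ?invr_ge0.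
  rewrite /B big_filter mulr_sumr [leRHS](bigID (fun c => c \in P n)) /=.
  rewrite -[leLHS]add0r lerD ?sumr_ge0 // => [c _|].
    by rewrite mulr_ge0 ?exprn_ge0 ?invr_ge0.
  apply: ler_sum => c; rewrite inP -ltnNge => nl; apply: le_trans (u_le c) _.
  rewrite ler_wpM2r ?exprn_ge0 // ler_wiXn2l ?invr_ge0 ?(ltnW nl) //.
  by rewrite invf_le1 ?ler1n.
have hX : `|X| <= 2.
  have [h1 _] := prod1B_bound (P n) (fun c => u ^+ l c).
  rewrite /X horner_partial_product; apply: le_trans h1 _.
  have le12 : \sum_(c <- P n) `|u ^+ l c| <= 2^-1.
    by apply: le_trans (sum_euler_radius (P n)); apply: ler_sum.
  have /andP[_ h] := prod1D_bound (fun c => normr_ge0 (u ^+ l c)) le12.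
  by apply: le_trans h _; apply: one_plus_double.
have hY : `|\prod_(c <- B) (1 - u ^+ l c) - 1| <= 2^-1 ^+ n.
  have [_ h2] := prod1B_bound B (fun c => u ^+ l c).
  apply: le_trans h2 _; rewrite lerBlDl.
  have le12 : \sum_(c <- B) `|u ^+ l c| <= 2^-1.
    by apply: le_trans sumB _; rewrite ler_piMl ?invr_ge0.
  have /andP[_ h] := prod1D_bound (fun c => normr_ge0 (u ^+ l c)) le12.
  apply: le_trans h _; rewrite lerD2l -ler_pdivlMl // mulrC.
  exact: sumB.
set Y := \prod_(_ <- B) _ in hY *.
have -> : X * Y - euler_poly.[u] = X * (Y - 1) + (X - euler_poly.[u]) by ring.
apply: le_trans (ler_normD _ _) _; rewrite normrM.
have -> : 3 * 2^-1 ^+ n = 2 * 2^-1 ^+ n + 2^-1 ^+ n :> F by ring.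
by rewrite lerD ?partial_product_tail // ler_pM.
Qed.

End EulerProduct.

(** * Power series and inverses of polynomials *)

Section Complex.
Variable R : realType.
Local Notation C := [the numFieldType of R[i]].

Lemma complex_gt0 (e : C) : 0 < e -> exists2 r : R, 0 < r & e = r%:C%C.
Proof.
case: e => a b; rewrite ltcE /= => /andP[/eqP -> a0]; by exists a.
Qed.

Lemma cvg_expr0 (c : C) : `|c| < 1 -> (c ^+ n @[n --> \oo] --> (0 : C)).
Proof.
move=> c1; apply/cvgrPdist_lt => e /complex_gt0[r r0 ->].
have [s sE] : exists s : R, `|c| = s%:C%C by eexists; rewrite normc_def.
have s0 : 0 <= s by have := normr_ge0 c; rewrite sE -[0 : C]/(0%:C%C) lecR.
have s1 : `|s| < 1 by move: c1; rewrite sE -[1 : C]/(1%:C%C) ltcR ger0_norm.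
have := cvg_expr s1 => /cvgrPdist_lt/(_ r r0); apply: filterS => n.
rewrite !sub0r !normrN [ `|c ^+ n| ]normrX sE -rmorphXn /= ltcR; apply: le_lt_trans.
by rewrite ger0_norm // exprn_ge0.
Qed.

End Complex.

Section PowerSeries.
Variable F : numFieldType.
(** An ordered field need not be archimedean, so this is assumed of [F]; [cvg_expr0] supplies it for
    [R[i]]. *)
Hypothesis cvg_expr_lt1 : forall c : F, `|c| < 1 -> (c ^+ n @[n --> \oo] --> (0 : F)).

Lemma expr_lt (c K e : F) : 0 <= c < 1 -> 0 <= K -> 0 < e ->
  \forall n \near \oo, K * c ^+ n < e.
Proof.
move=> /andP[c0 c1] K0 e0.
have : K * c ^+ n @[n --> \oo] --> K * 0.
  by apply: cvgMr; apply: cvg_expr_lt1; rewrite ger0_norm.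
rewrite mulr0 => /cvgrPdist_lt/(_ e e0); apply: filterS => n.
by rewrite sub0r normrN ger0_norm // mulr_ge0 // exprn_ge0.
Qed.

Lemma cvg_affine_rec (c L : F) (x s : nat -> F) : `|c| < 1 ->
  (forall n, x n.+1 = s n + c * x n) -> s @ \oo --> L -> x @ \oo --> L / (1 - c).
Proof.
move=> c1 xE sL.
have c1' : 1 - c != 0.
  rewrite subr_eq0; apply: contraTneq c1 => <-; by rewrite normr1 ltxx.
have k0 : 0 < 1 - `|c| by rewrite subr_gt0.
pose y n := x n - L / (1 - c).
have yE n : y n.+1 = (s n - L) + c * y n by rewrite /y xE; field.
apply/cvgrPdist_lt => e e0.
(* With perturbations of at most this size, [e / 2] is a fixed point of the error recursion, and the
   initial error decays geometrically. *)
have e1 : 0 < e / 2 * (1 - `|c|) by rewrite mulr_gt0 ?divr_gt0.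
have /cvgrPdist_le/(_ _ e1)[N _ HN] := sL.
have bound k : `|y (N + k)%N| <= `|c| ^+ k * `|y N| + e / 2.
  elim: k => [|k IHk]; first by rewrite addn0 mul1r lerDl divr_ge0 ?ltW.
  rewrite addnS yE; apply: le_trans (ler_normD _ _) _; rewrite normrM.
  have h1 : `|s (N + k)%N - L| <= e / 2 * (1 - `|c|).
    by rewrite distrC; apply: HN; rewrite /= leq_addr.
  apply: le_trans (lerD h1 (ler_wpM2l (normr_ge0 c) IHk)) _.
  rewrite exprS le_eqVlt; apply/orP; left; apply/eqP; by ring.
have c01 : 0 <= `|c| < 1 by rewrite normr_ge0.
have [N' _ HN'] := expr_lt c01 (normr_ge0 (y N)) (divr_gt0 e0 (ltr0n F 2)).
exists (N + N')%N => // n /= hn; rewrite distrC -/(y n).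
have -> : n = (N + (n - N))%N by rewrite subnKC // (leq_trans (leq_addr _ _) hn).
apply: le_lt_trans (bound _) _; rewrite [ltRHS]splitr ltrD2r mulrC.
by apply: HN'; rewrite /= leq_subRL // (leq_trans (leq_addr _ _) hn).
Qed.

(* The coefficients of the expansion of [1 / euler_poly lam] at 0. *)
Fixpoint inv_coef (lam : seq F) : nat -> F :=
  if lam is x :: s then fun n => \sum_(k < n.+1) x ^+ (n - k) * inv_coef s k
  else fun n => (n == 0%N)%:R.

Lemma inv_coef_cons0 x s : inv_coef (x :: s) 0 = inv_coef s 0.
Proof. by rewrite /= big_ord1 mul1r. Qed.

Lemma inv_coef_consS x s n :
  inv_coef (x :: s) n.+1 = inv_coef s n.+1 + x * inv_coef (x :: s) n.
Proof.
rewrite /= big_ord_recr /= subnn mul1r addrC; congr (_ + _).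
rewrite mulr_sumr; apply: eq_bigr => k _; rewrite mulrA -exprS.
by rewrite subSn // -ltnS.
Qed.

Lemma inv_coef_nil n : inv_coef [::] n = (n == 0%N)%:R. Proof. by []. Qed.

Arguments inv_coef : simpl never.

(** Multiplication by [1 - x u] on partial sums. Read forwards it is a recursion for
    [cvg_affine_rec]; read backwards it removes a factor with no bound on [u]. *)
Lemma series_inv_coef x s u n :
  [series inv_coef (x :: s) n * u ^+ n]_n n.+1 =
  [series inv_coef s n * u ^+ n]_n n.+1 + x * u * [series inv_coef (x :: s) n * u ^+ n]_n n.
Proof.
rewrite /series /=; elim: n => [|n IHn].
  by rewrite !big_nat1 big_geq // mulr0 addr0 inv_coef_cons0.
have recr (a : nat -> F) m : \sum_(0 <= k < m.+1) a k = \sum_(0 <= k < m) a k + a m.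
  exact: big_nat_recr.
rewrite [LHS]recr [in LHS]IHn [X in _ = X + _]recr [X in _ = _ + _ * X]recr inv_coef_consS.
by rewrite exprS; ring.
Qed.

Lemma euler_poly_cons (x : F) s u :
  (euler_poly (x :: s)).[u] = (1 - x * u) * (euler_poly s).[u].
Proof. by rewrite /euler_poly big_cons hornerM !hornerE. Qed.

Lemma cvg_series_inv_coef (lam : seq F) u : (forall x, x \in lam -> `|x * u| < 1) ->
  [series inv_coef lam n * u ^+ n]_n @ \oo --> ((euler_poly lam).[u])^-1.
Proof.
elim: lam => [|x s IHs] h.
  rewrite /euler_poly big_nil hornerC invr1 -(cvg_shiftS _).
  apply: cvg_near_cst; near=> n; rewrite /series /=.
  rewrite big_nat_recl //= big1 ?addr0 ?mulr1 // => k _; by rewrite inv_coef_nil mul0r.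
rewrite euler_poly_cons invfM mulrC.
apply: (cvg_affine_rec (h x (mem_head _ _)) (series_inv_coef x s u)).
rewrite cvg_shiftS; apply: IHs => y ys; apply: h; by rewrite inE ys orbT.
Unshelve. all: by end_near. Qed.

(** Convergence passes from [x :: s] down to [s] for every [u]. In particular the series diverges at
    each root of the polynomial, even on the boundary of the disc. *)
Lemma cvg_series_inv_coef_inv (lam : seq F) (u L : F) :
  [series inv_coef lam n * u ^+ n]_n @ \oo --> L -> L * (euler_poly lam).[u] = 1.
Proof.
elim: lam L => [|x s IHs] L h.
  rewrite /euler_poly big_nil hornerC mulr1.
  have := @cvg_series_inv_coef [::] u.
  move=> /(_ _)/wrap[x|]; first by rewrite in_nil.
  by rewrite /euler_poly big_nil hornerC invr1; exact: (cvg_unique _ h).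
rewrite euler_poly_cons mulrA; apply: IHs; rewrite -cvg_shiftS.
rewrite (_ : (fun n => _) = (fun n => [series inv_coef (x :: s) n * u ^+ n]_n n.+1
  - x * u * [series inv_coef (x :: s) n * u ^+ n]_n n)); last first.
  by apply/funext => n; rewrite series_inv_coef addrK.
have -> : L * (1 - x * u) = L - x * u * L by ring.
apply: cvgB; first by rewrite cvg_shiftS.
by apply: cvgM => //; exact: cvg_cst.
Qed.

Lemma geometric_sum_le2 (t : F) m : 0 <= t <= 2^-1 -> \sum_(k < m) t ^+ k <= 2.
Proof.
move=> /andP[t0 t1]; elim: m => [|m IHm]; first by rewrite big_ord0.
rewrite big_ord_recl expr0; under eq_bigr do rewrite /= /bump /= exprS.
rewrite -mulr_sumr -[leRHS]/(1 + 1) lerD2l.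
apply: le_trans (_ : 2^-1 * 2 <= 1); last by rewrite mulVf.
by rewrite ler_pM // sumr_ge0 // => k _; exact: exprn_ge0.
Qed.

(** By strong induction the coefficients below [n] vanish. Convergence at one point [v] bounds the
    tail at a smaller [w] geometrically, which leaves [|c n| <= w K] for all small [w > 0]. *)
Lemma power_series_eq0 (c : nat -> F) :
  (\forall u \near (0 : F), [series c n * u ^+ n]_n @ \oo --> (0 : F)) ->
  forall n, c n = 0.
Proof.
case/nbhs_ballP => r /= r0 hr n.
have [m] := ubnP n; elim: m n => // m IHm n /ltnSE nm.
have c0 k : (k < n)%N -> c k = 0 by move=> kn; apply: IHm; exact: leq_trans nm.
pose v := r / 2.
have v0 : 0 < v by rewrite divr_gt0.
have vr : ball 0 r v.
  rewrite /ball /= sub0r normrN gtr0_norm // ltr_pdivrMr // ltr_pMr // ltr1n.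
  by [].
have [B B0 HB] : exists2 B, 0 < B & forall k, `|c k * v ^+ k| <= B.
  have /cvg_series_cvg_0 := cvgP _ (hr v vr).
  move=> /cvgP/cvg_seq_bounded/pinfty_ex_gt0[B B0 HB].
  by exists B => // k; exact: HB.
(* The [1] absorbs the allowed error [w ^+ n.+1] in the limit, the other term the tail, whose ratio
   [w / v] is at most [1 / 2]. *)
pose K := 1 + 2 * B / v ^+ n.+1.
have K0 : 0 < K by rewrite addr_gt0 // divr_gt0 ?mulr_gt0 ?exprn_gt0.
have key w : 0 < w -> w <= v / 2 -> `|c n| <= w * K.
  move=> w0 wv.
  have wr : ball 0 r w.
    rewrite /ball /= sub0r normrN gtr0_norm //; apply: le_lt_trans wv _.
    rewrite ltr_pdivrMr // (lt_trans (_ : v < r)) //.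
      by rewrite ltr_pdivrMr // ltr_pMr // ltr1n.
    by rewrite ltr_pMr // ltr1n.
  have /cvgrPdist_le/(_ _ (exprn_gt0 n.+1 w0))[m' _ Hm'] := hr w wr.
  have := Hm' (n.+1 + m')%N; rewrite /= leq_addl sub0r normrN => /(_ isT).
  rewrite /series /= (@big_cat_nat _ _ _ n.+1) ?leq_addr //=.
  rewrite big_nat_recr //= big_nat big1 ?add0r; last first.
    by move=> k /andP[_ kn]; rewrite c0 // mul0r.
  set T := \sum_(_ <= _ < _) _ => hT.
  have leT : `|T| <= B * (w / v) ^+ n.+1 * 2.
    rewrite /T -{1}[n.+1]add0n big_addn addKn big_mkord.
    apply: le_trans (ler_norm_sum _ _ _) _.
    apply: le_trans (_ : \sum_(k < m') B * (w / v) ^+ n.+1 * (w / v) ^+ k <= _).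
      apply: ler_sum => k _; rewrite -mulrA -exprD.
      have -> : c (k + n.+1)%N * w ^+ (k + n.+1) =
          c (k + n.+1)%N * v ^+ (k + n.+1) * (w / v) ^+ (n.+1 + k).
        by rewrite [(n.+1 + k)%N]addnC -mulrA -exprMn mulrCA divff ?mulr1 // gt_eqF.
      by rewrite normrM ler_pM ?HB // normrX ger0_norm // divr_ge0 // ltW.
    rewrite -mulr_sumr ler_wpM2l //.
      by rewrite mulr_ge0 ?(ltW B0) // exprn_ge0 // divr_ge0 // ltW.
    apply: geometric_sum_le2; apply/andP; split; first by rewrite divr_ge0 // ltW.
    by rewrite ler_pdivrMr // mulrC.
  have : `|c n * w ^+ n| <= w ^+ n * (w * K).
    rewrite -(addrK T (c n * w ^+ n)); apply: le_trans (ler_normB _ _) _.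
    apply: le_trans (lerD hT leT) _; rewrite le_eqVlt; apply/orP; left; apply/eqP.
    rewrite /K exprMn exprVn !exprS; field.
    by rewrite expf_neq0 gt_eqF.
  by rewrite normrM [ `|w ^+ n| ]gtr0_norm ?exprn_gt0 // mulrC ler_pM2l // exprn_gt0.
apply/eqP; rewrite -normr_eq0; apply/negPn/negP => cn0.
have cn : 0 < `|c n| by rewrite lt_def cn0 normr_ge0.
have d0 : 0 < `|c n| + K * v by rewrite addr_gt0 ?mulr_gt0.
(* This single quotient is below both [v / 2] and [|c n| / K], in place of a minimum. *)
pose z := v / 2 * (`|c n| / (`|c n| + K * v)).
have z0 : 0 < z by rewrite mulr_gt0 ?divr_gt0.
have zv : z <= v / 2.
  rewrite ler_piMr ?(ltW (divr_gt0 _ _)) // ler_pdivrMr // mul1r lerDl.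
  by rewrite mulr_ge0 // ltW.
have := key z z0 zv; rewrite lt_geF //.
have -> : z * K = `|c n| * (K * v / 2 / (`|c n| + K * v)).
  by rewrite /z; field; rewrite gt_eqF.
rewrite gtr_pMr // ltr_pdivrMr // mul1r.
have Kv0 : 0 < K * v by rewrite mulr_gt0.
apply: lt_trans (_ : K * v < _); last by rewrite ltrDr.
by rewrite ltr_pdivrMr // ltr_pMr // ltr1n.
Qed.

End PowerSeries.

(** * Holomorphy and poles of the inverse of a polynomial *)

Section InversePolynomial.
Variable F : numFieldType.
Implicit Types (P : {poly F}) (z : F).

Lemma derivable_poly P (z : F) : derivable (horner P : F^o -> F^o) z 1.
Proof.
elim/poly_ind: P => [|P r IHP].
  have -> : horner (0 : {poly F}) = cst 0 by apply/funext => y /=; rewrite horner0.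
  exact: derivable_cst.
have -> : horner (P * 'X + r%:P) = (fun y => horner P y * y) + cst r.
  by apply/funext => y; rewrite !hornerE.
apply: derivableD; last exact: derivable_cst.
by apply: derivableM => //; exact: derivable_id.
Qed.

Lemma continuous_poly P : continuous (horner P : F -> F).
Proof.
move=> z; have /derivable1_diffP := @derivable_poly P z.
exact: (@differentiable_continuous _ F^o F^o).
Qed.

Lemma holomorphic_inv_poly P z : P.[z] != 0 ->
  holomorphic_near (fun w => (P.[w])^-1) z.
Proof.
move=> Pz; have : \forall w \near z, P.[w] != 0.
  exact: (cvgr_neq0 _ (@continuous_poly P z)).
apply: filterS => w Pw; exact: (derivableV Pw (@derivable_poly P w)).
Qed.

Lemma meromorphic_inv_poly P : P != 0 -> meromorphic (fun w => (P.[w])^-1).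
Proof.
move=> P0 z; have [n [Q /implyP/(_ P0) Qz PE]] := multiplicity_XsubC P z.
exists n, (fun w => (Q.[w])^-1); split; first exact: holomorphic_inv_poly.
apply: nearW => w; rewrite PE hornerM invfM horner_exp !hornerE.
by [].
Qed.

Lemma is_pole_inv_poly P z : P != 0 -> is_pole (fun w => (P.[w])^-1) z <-> root P z.
Proof.
move=> P0; split=> [pole|/rootP Pz].
  apply/negPn/negP => Pz; rewrite /root in Pz.
  have Zz : (P.[w])^-1 @[w --> z^'] --> (P.[z])^-1.
    by apply: cvg_within_filter; apply: cvgV => //; exact: continuous_poly.
  have /filter_ex[w [h1 h2]] : \forall w \near z^',
      `|(P.[w])^-1| < `|(P.[z])^-1| + 1 /\ `|(P.[z])^-1| + 1 < `|(P.[w])^-1|.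
    near=> w; split; near: w.
      by apply: (cvgr_norm_lt _ Zz); rewrite ltrDl.
    by move/cvgryPgtr: pole; apply; rewrite realD // realE normr_ge0.
  by have := lt_trans h1 h2; rewrite ltxx.
apply/cvgryPgtr => A Areal; near=> w.
have A1 : 0 < `|A| + 1 by rewrite ltr_wpDl.
have Pw : P.[w] != 0.
  near: w; have [n [Q /implyP/(_ P0) Qz PE]] := multiplicity_XsubC P z.
  have : \forall w \near z^', Q.[w] != 0.
    by apply: nbhs_dnbhs; exact: (cvgr_neq0 _ (@continuous_poly Q z)).
  apply: filterS2 (nbhs_dnbhs_neq z) => w wz Qw.
  by rewrite PE hornerM horner_exp !hornerE mulf_neq0 // expf_neq0 // subr_eq0.
have Pw_lt : `|P.[w]| < (`|A| + 1)^-1.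
  near: w; have Pc : P.[w] @[w --> z^'] --> P.[z].
    by apply: cvg_within_filter; exact: continuous_poly.
  by apply: (cvgr_norm_lt _ Pc); rewrite Pz normr0 invr_gt0.
rewrite normfV; apply: (@lt_trans _ _ (`|A| + 1)).
  by rewrite (le_lt_trans (real_ler_norm Areal)) // ltrDl.
by rewrite -[ltLHS]invrK ltf_pV2 // posrE ?invr_gt0 // normr_gt0.
Unshelve. all: by end_near. Qed.

End InversePolynomial.

(** * Unconditional convergence of the Euler product near 0 *)

Section RationalZeta.
Variables (F : numFieldType).
Hypothesis cvg_expr_lt1 : forall c : F, `|c| < 1 -> (c ^+ n @[n --> \oo] --> (0 : F)).
Variables (I : choiceType) (l : I -> nat).
Hypothesis l_gt0 : forall c, (0 < l c)%N.
Variable P : nat -> {fset I}.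
Hypothesis inP : forall n c, (c \in P n) = (l c <= n)%N.
Variables (lam : seq F) (M : nat).
Hypothesis M_gt0 : (0 < M)%N.
Hypothesis N_lam : forall n, (0 < n)%N ->
  (\sum_(c <- P n | (l c %| n)%N) l c)%N%:R = \sum_(x <- lam) x ^+ n.
Hypothesis N_le : forall n, (0 < n)%N -> (\sum_(c <- P n | l c %| n) l c <= M ^ n)%N.
Hypothesis lam_le : forall x, x \in lam -> `|x| <= M%:R.

Lemma root_euler_poly u : root (euler_poly lam) u <-> exists2 x, x \in lam & x * u = 1.
Proof.
rewrite /euler_poly /root horner_prod prodf_seq_eq0; split=> [/hasP[x xl]|[x xl xu]].
  by rewrite !hornerE subr_eq0 => /eqP xu; exists x.
by apply/hasP; exists x; rewrite // !hornerE xu subrr.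
Qed.

Lemma small_lam u x : `|u| <= euler_radius F M / 2 -> x \in lam -> `|x * u| < 1.
Proof.
move=> ur xl; rewrite normrM; apply: le_lt_trans (ler_pM _ _ (lam_le xl) ur) _ => //.
rewrite /euler_radius natrM invfM mulrA mulrCA divff ?pnatr_eq0 -?lt0n // mulr1.
by rewrite -invfM invf_lt1 // -natrM ltr1n.
Qed.

Lemma horner_euler_poly_neq0 u : `|u| <= euler_radius F M / 2 -> (euler_poly lam).[u] != 0.
Proof.
move=> ur; apply/negP => /root_euler_poly[x xl xu].
by have := small_lam ur xl; rewrite xu normr1 ltxx.
Qed.

Lemma cvg_euler_product u : `|u| <= euler_radius F M / 2 ->
  (fun A : {fset I} => \prod_(c <- A) (1 - u ^+ l c)^-1) @ totally
    --> ((euler_poly lam).[u])^-1.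
Proof.
move=> ur; have tf := @totally_filter I.
under eq_fun do rewrite prodfV.
apply: cvgV; first exact: horner_euler_poly_neq0.
apply/cvgrPdist_lt => e e0.
have h01 : 0 <= (2^-1 : F) < 1 by rewrite invr_ge0 ler0n invf_lt1 // ltr1n.
have [n0 _ Hn0] := expr_lt cvg_expr_lt1 h01 (ler0n F 3) e0.
pose n := maxn n0 (size lam).
exists (P n) => // A /= PA; rewrite distrC.
apply: le_lt_trans (Hn0 n (leq_maxl _ _)).
apply: (euler_product_tail l_gt0 inP M_gt0 N_lam N_le) => //; first exact: leq_maxr.
exact/fsubsetP.
Qed.

Lemma near_small : \forall u \near (0 : F), `|u| <= euler_radius F M / 2.
Proof.
have h : 0 < euler_radius F M / 2 by rewrite divr_gt0 // euler_radius_gt0.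
near=> u; rewrite -normrN -[- u]add0r; apply/ltW.
near: u; exact: (@cvgr_dist_lt _ _ _ _ _ id 0 (fun _ => id)).
Unshelve. all: by end_near. Qed.

End RationalZeta.

(** * The zeta function of a graph of groups from its closed words *)

Section GogZeta.
Variable R : realType.
Local Notation C := [the numFieldType of R[i]].
Variable X : graph_of_groups.
Hypothesis l_gt0 : forall c : prime_class X, (0 < class_length c)%N.
Variable P : nat -> {fset prime_class X}.
Hypothesis inP : forall n (c : prime_class X), (c \in P n) = (class_length c <= n)%N.
Variables (lam : seq C) (M q : nat).
Hypothesis M_gt0 : (0 < M)%N.
Hypothesis N_lam : forall n, (0 < n)%N ->
  (\sum_(c <- P n | (class_length c %| n)%N) class_length c)%N%:R = \sum_(x <- lam) x ^+ n.
Hypothesis N_le : forall n, (0 < n)%N ->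
  (\sum_(c <- P n | class_length c %| n) class_length c <= M ^ n)%N.
Hypotheses (q_gt0 : (0 < q)%N) (qM : (q <= M)%N).
Hypothesis lam_le : forall x, x \in lam -> `|x| <= q%:R.
Hypothesis q_lam : q%:R \in lam.

Definition zeta_fun : C -> C := fun u => ((euler_poly lam).[u])^-1.

Let lam_leM x : x \in lam -> `|x| <= M%:R.
Proof. by move=> /lam_le h; apply: le_trans h _; rewrite ler_nat. Qed.

Lemma euler_poly_neq0 : euler_poly lam != 0.
Proof.
apply/eqP => D0; have := @horner_euler_poly_neq0 C lam M M_gt0 lam_leM 0.
rewrite normr0 D0 horner0 eqxx => /(_ _)/negP; apply=> //.
by rewrite divr_ge0 // ltW // euler_radius_gt0.
Qed.

Lemma near_zeta_product : \forall u \near (0 : C), zeta_product X u (zeta_fun u).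
Proof.
have := near_small C M_gt0; apply: filterS => u ur.
exact: (cvg_euler_product (@cvg_expr0 R) l_gt0 inP M_gt0 N_lam N_le lam_leM ur).
Qed.

Lemma zeta_continuation_zeta_fun : zeta_continuation X zeta_fun.
Proof.
split; last exact: near_zeta_product.
exact: (meromorphic_inv_poly euler_poly_neq0).
Qed.

Lemma zeta_product_uniq (u z z' : C) : zeta_product X u z -> zeta_product X u z' -> z = z'.
Proof.
have tf := @totally_filter [the choiceType of prime_class X].
exact: cvg_unique.
Qed.

Lemma near_series_inv_coef : \forall u \near (0 : C),
  [series inv_coef lam n * u ^+ n]_n @ \oo --> zeta_fun u.
Proof.
have := near_small C M_gt0; apply: filterS => u ur.
apply: (cvg_series_inv_coef (@cvg_expr0 R)) => x xl.
exact: (small_lam M_gt0 lam_leM ur xl).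
Qed.

Lemma zeta_expansion_inv_coef : zeta_expansion X (inv_coef lam).
Proof.
have := near_series_inv_coef; have := near_zeta_product.
by apply: filterS2 => u h1 h2; exists (zeta_fun u).
Qed.

(** An upper bound for the radius must control every expansion; the difference of two of them is a
    power series that vanishes near 0. *)
Lemma zeta_expansion_uniq (a : nat -> C) : zeta_expansion X a -> a = inv_coef lam.
Proof.
move=> ha; apply/funext => n; apply/eqP; rewrite -subr_eq0; apply/eqP.
move: n; apply: (@power_series_eq0 C (fun n => a n - inv_coef lam n)).
have := near_zeta_product; have := near_series_inv_coef; move: ha.
apply: filterS3 => u [z az zz] hz zz'.
rewrite (zeta_product_uniq zz zz') in az.
have -> : [series (a n - inv_coef lam n) * u ^+ n]_n =
    (fun n => [series a n * u ^+ n]_n n - [series inv_coef lam n * u ^+ n]_n n).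
  apply/funext => n; rewrite /series /= -sumrB; apply: eq_bigr => k _.
  by rewrite mulrBl.
rewrite -(subrr (zeta_fun u)); exact: cvgB.
Qed.

(** The point [1 / q] is a root of the polynomial, where convergence would give [0 = 1]; inside the
    disc [|x * u| < 1] for every eigenvalue [x]. *)
Lemma zeta_radiusE : zeta_radius R X = (q%:R^-1)%:E.
Proof.
have q0 : 0 < q%:R :> R by rewrite ltr0n.
apply/eqP; rewrite eq_le; apply/andP; split.
  apply: ub_ereal_sup => _ [r [r0 [a ha cva]] <-]; rewrite lee_fin leNgt.
  apply/negP => qr; pose u := (q%:R^-1)%:C%C : C.
  have uq : q%:R * u = 1 :> C.
    by rewrite /u -(rmorph_nat (real_complex R)) -rmorphM /= divff ?rmorph1 // gt_eqF.
  have : `|u| < r%:C%C.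
    by rewrite normc_def /= expr0n addr0 sqrtr_sqr ger0_norm ?invr_ge0 ?ltW // ltcR.
  move=> /cva/cvg_ex[L]; rewrite (zeta_expansion_uniq ha).
  move=> /(cvg_series_inv_coef_inv (@cvg_expr0 R)).
  have /rootP -> : root (euler_poly lam) u by apply/root_euler_poly; exists q%:R.
  by move/eqP; rewrite mulr0 eq_sym oner_eq0.
apply: ereal_sup_ubound; exists (q%:R^-1) => //; split; first by rewrite invr_ge0 ltW.
exists (inv_coef lam); first exact: zeta_expansion_inv_coef.
move=> u uq; apply/cvg_ex; exists (zeta_fun u).
apply: (cvg_series_inv_coef (@cvg_expr0 R)) => x /lam_le xq.
rewrite normrM; case: (eqVneq x 0) => [->|x0]; first by rewrite normr0 mul0r.
apply: (@le_lt_trans _ _ (q%:R * `|u|)); first by rewrite ler_wpM2r.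
rewrite -ltr_pdivlMl ?ltr0n // mulr1; apply: lt_le_trans uq _.
by rewrite rmorphV ?unitfE ?gt_eqF // rmorph_nat.
Qed.

Lemma exists_gap (s : seq R) (a : R) :
  exists2 e : R, 0 < e & forall x, x \in s -> a < x -> a + e < x.
Proof.
elim: s => [|y s [e e0 he]]; first by exists 1.
case: (ltP a y) => ay; last first.
  exists e => // x; rewrite inE => /orP[/eqP -> /lt_le_trans/(_ ay)|]; last exact: he.
  by rewrite ltxx.
exists (Num.min e ((y - a) / 2)).
  by rewrite lt_min e0 divr_gt0 // subr_gt0.
move=> x; rewrite inE => /orP[/eqP -> _|xs /(he x xs)].
  apply: (@le_lt_trans _ _ (a + (y - a) / 2)); first by rewrite lerD2l ge_min lexx orbT.
  lra.
by apply: le_lt_trans; rewrite lerD2l ge_min lexx.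
Qed.

Lemma cabs_norm (u : C) : (cabs u)%:C%C = `|u|.
Proof. by rewrite /cabs normc_def. Qed.

Lemma pole_free_sup_ge : ((q%:R^-1)%:E <= pole_free_sup X zeta_fun)%E.
Proof.
(* All moduli of poles occur in this list. An eigenvalue 0 contributes the inverse of 0, which is 0
   and so not above [1 / q]. *)
have [e e0 he] := exists_gap [seq (cabs x)^-1 | x <- lam] (q%:R^-1 : R).
apply: (@le_trans _ _ (q%:R^-1 + e)%:E); first by rewrite lee_fin lerDl ltW.
apply: ereal_sup_ubound; exists (q%:R^-1 + e) => //; exists e; split=> //.
  by rewrite zeta_radiusE EFinD.
rewrite zeta_radiusE => u /(is_pole_inv_poly _ euler_poly_neq0)/root_euler_poly[x xl xu].
rewrite !lee_fin => /andP[h1 h2]; congr EFin; apply/eqP; rewrite eq_le h1 andbT.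
rewrite leNgt; apply/negP => h3.
have ux : cabs u = (cabs x)^-1.
  have : (cabs x)%:C%C * (cabs u)%:C%C = 1 :> C by rewrite !cabs_norm -normrM xu normr1.
  rewrite -rmorphM => /(congr1 (@complex.Re R)) /= xu1.
  have x0 : cabs x != 0 by apply: contra_eq_neq xu1 => ->; rewrite mul0r eq_sym oner_eq0.
  by apply: (mulfI x0); rewrite xu1 divff.
have := he (cabs u); rewrite h3 => /(_ _ isT).
rewrite ltNge h2 => /(_ _)/negP; apply=> //.
by rewrite ux; apply: map_f.
Qed.

Lemma pole_free_sup_le (x : R) : 0 < x -> x < q%:R -> x%:C%C \in lam ->
  (pole_free_sup X zeta_fun <= (x^-1)%:E)%E.
Proof.
move=> x0 xq xl; apply: ub_ereal_sup => _ [rho [e [e0 rhoE h]] <-].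
rewrite lee_fin leNgt; apply/negP => xrho.
have cu : cabs ((x^-1)%:C%C : C) = x^-1.
  by rewrite /cabs normc_def /= expr0n addr0 sqrtr_sqr ger0_norm // invr_ge0 ltW.
have xq' : q%:R^-1 < x^-1 by rewrite ltf_pV2 ?posrE // ltr0n.
have pole : is_pole zeta_fun ((x^-1)%:C%C : C).
  apply/(is_pole_inv_poly _ euler_poly_neq0)/root_euler_poly; exists x%:C%C => //.
  by rewrite -rmorphM /= divff ?rmorph1 // gt_eqF.
have := h _ pole; rewrite cu zeta_radiusE !lee_fin (ltW xq') (ltW xrho).
by move=> /(_ isT) e'; have := xq'; rewrite (EFin_inj e') ltxx.
Qed.

End GogZeta.

(** * The nonbacktracking matrix *)

Lemma trig_powP (F : fieldType) n (U : 'M[F]_n) k : is_trig_mx U ->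
  is_trig_mx (U ^+ k) /\ forall i, (U ^+ k) i i = U i i ^+ k.
Proof.
move=> /is_trig_mxP tU; elim: k => [|k [/is_trig_mxP tk dk]].
  split=> [|i]; last by rewrite !expr0 mxE eqxx.
  by apply/is_trig_mxP => i j ij; rewrite expr0 mxE -val_eqE /= ltn_eqF.
split=> [|i].
  apply/is_trig_mxP => i j ij; rewrite exprS mxE big1 // => h _.
  case: (ltnP i h) => ih; first by rewrite tU ?mul0r.
  by rewrite tk ?mulr0 // (leq_ltn_trans ih).
rewrite exprS mxE (bigD1 i) //= dk exprS big1 ?addr0 // => h hi.
case: (ltngtP i h) => ih; first by rewrite tU ?mul0r.
  by rewrite tk ?mulr0.
by case/eqP: hi; apply/val_inj.
Qed.

(** By Schur triangularisation the diagonal lists the eigenvalues with multiplicity, and the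
    diagonals of the powers list their powers. *)
Lemma trace_pow_eigenvalues (F : numClosedFieldType) n (A : 'M[F]_n) :
  exists lam : seq F, (forall k, \tr (A ^+ k) = \sum_(x <- lam) x ^+ k) /\
    (forall x, (x \in lam) = eigenvalue A x).
Proof.
case: n A => [|n] A.
  exists [::]; split=> [k|x]; first by rewrite big_nil /mxtrace big_ord0.
  by apply/esym/negbTE/eigenvalueP => -[v _]; rewrite [v]thinmx0 eqxx.
have [P Pu PA] := Schur A (ltn0Sn n).
have Pun : P \in unitmx by exact: unitarymx_unit.
pose U := P *m A *m invmx P.
have tU : is_trig_mx U by have := PA; rewrite /similar_to /= conjumx.
have AE k : P *m A ^+ k *m invmx P = U ^+ k.
  elim: k => [|k IHk]; first by rewrite !expr0 mulmx1 mulmxV.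
  rewrite !exprS -IHk /U -!mulmxE !mulmxA mulmxKV //.
exists [seq U i i | i <- enum 'I_n.+1]; split=> [k|x].
  rewrite big_map big_enum /=.
  have -> : \tr (A ^+ k) = \tr (U ^+ k).
    by rewrite -AE mxtrace_mulC mulmxA mulVmx // mul1mx.
  by apply: eq_bigr => i _; rewrite (trig_powP k tU).2.
have -> : eigenvalue A x = eigenvalue U x.
  apply/eigenvalueP/eigenvalueP => -[v vA v0].
    exists (v *m invmx P); first by rewrite /U !mulmxA mulmxKV // vA scalemxAl.
    by apply: contra_neq v0 => /(congr1 (mulmx^~ P)); rewrite mulmxKV // mul0mx.
  exists (v *m P); first by rewrite scalemxAl -vA /U !mulmxA mulmxKV.
  by apply: contra_neq v0 => /(congr1 (mulmx^~ (invmx P))); rewrite mulmxK // mul0mx.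
rewrite eigenvalue_root_char char_poly_trig // /root horner_prod prodf_seq_eq0.
apply/mapP/hasP => [[i _ ->]|[i _]].
  by exists i; rewrite ?mem_index_enum // !hornerE subrr.
by rewrite !hornerE subr_eq0 => /eqP ->; exists i => //; rewrite mem_enum.
Qed.

Section ClosedWords.
Variables (F : fieldType) (E : finType) (r : rel E).

Definition adjmx : 'M[F]_#|E| := \matrix_(a, b) (r (enum_val a) (enum_val b))%:R.

Lemma sum_tuple_cons n (G : n.+1.-tuple E -> F) :
  \sum_u G u = \sum_x \sum_(u : n.-tuple E) G [tuple of x :: u].
Proof.
rewrite pair_bigA /=; apply: reindex.
exists (fun u : n.+1.-tuple E => (thead u, [tuple of behead u])) => [[x u]|u] _ /=.
  by congr pair; apply/val_inj.
by rewrite -tuple_eta.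
Qed.

Lemma adjmx_pow n x y : (adjmx ^+ n) (enum_rank x) (enum_rank y) =
  \sum_(u : n.-tuple E) (path r x u && (last x u == y))%:R.
Proof.
elim: n x => [|n IHn] x.
  rewrite expr0 mxE (inj_eq enum_rank_inj) (big_pred1 [tuple]) // => u.
  by apply/esym/eqP; exact: tuple0.
rewrite exprS mxE sum_tuple_cons (reindex (@enum_rank E)) /=; last exact/onW_bij/enum_rank_bij.
apply: eq_bigr => z _; rewrite IHn mxE !enum_rankK mulr_sumr.
by apply: eq_bigr => u _; rewrite -natrM mulnb andbA.
Qed.

Lemma trace_adjmx n : (0 < n)%N ->
  \tr (adjmx ^+ n) = #|[pred u : n.-tuple E | cycle r u]|%:R.
Proof.
move=> n0; rewrite /mxtrace (reindex (@enum_rank E)) /=; last exact/onW_bij/enum_rank_bij.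
rewrite (eq_bigr _ (fun x _ => adjmx_pow n x x)) exchange_big.
rewrite -sum1_card natr_sum [RHS]big_mkcond /=; apply: eq_bigr => u _.
rewrite -mulrb inE /=; case: n n0 u => // n _ u.
case: (tval u) (size_tuple u) => //= e s _.
(* The tuple records the letters after the start, so a closed path must start at its last letter:
   one starting letter survives. *)
rewrite (bigD1 (last e s)) //= eqxx andbT big1 ?addr0; last first.
  by move=> x; rewrite eq_sym => /negbTE ->; rewrite andbF.
by rewrite rcons_path andbC.
Qed.

End ClosedWords.

(** * Eigenvalues of the nonbacktracking matrix of a regular graph *)

Section RegularGraph.
Variables (V E : finType) (t : E -> V) (i : E -> E).
Hypotheses (iK : involutive i) (i_neq : forall e, i e <> e).
Variable q : nat.
Hypothesis deg : forall x, #|[pred e | t (i e) == x]| = q.+1.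
Variable F : numFieldType.

Notation T := (adjmx F (adj t i)).

(** Of the [q + 1] edges that leave [t e] only [i e] backtracks. *)
Lemma out_degree e : (\sum_(f | adj t i e f) 1 = q)%N.
Proof.
have := deg (t e); rewrite -sum1_card (bigD1 (i e)) /=; last by rewrite inE iK.
case=> <-; apply: eq_bigl => f; rewrite inE /adj /nonback eq_sym.
by [].
Qed.

(** The rows of [T] sum to [q], so on row vectors [T] enlarges the l1-norm by at most the factor
    [q]. *)
Lemma eigenvalue_le x : eigenvalue T x -> `|x| <= q%:R.
Proof.
case/eigenvalueP => v vT v0.
have s0 : 0 < \sum_a `|v 0 a|.
  rewrite lt_def sumr_ge0 ?andbT => [|a _]; last exact: normr_ge0.
  apply: contra_neq v0 => /eqP; rewrite psumr_eq0 => [/allP h|a _]; last exact: normr_ge0.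
  apply/rowP => a; rewrite mxE; apply/eqP; rewrite -normr_eq0.
  by apply: h; rewrite mem_index_enum.
rewrite -(ler_pM2r s0) mulr_sumr.
rewrite (eq_bigr (fun a => `|\sum_c v 0 c * T c a|)) => [|a _]; last first.
  by rewrite -normrM; congr `| _ |; have /rowP/(_ a) := vT; rewrite !mxE.
apply: (@le_trans _ _ (\sum_a \sum_c `|v 0 c| * T c a)).
  apply: ler_sum => a _; apply: le_trans (ler_norm_sum _ _ _) _.
  by apply: ler_sum => c _; rewrite normrM mxE normr_nat.
rewrite exchange_big /= mulr_sumr; apply: ler_sum => c _.
rewrite -mulr_sumr mulrC ler_wpM2r // -(out_degree (enum_val c)) natr_sum.
rewrite (reindex (@enum_rank E)) /=; last exact/onW_bij/enum_rank_bij.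
rewrite [leRHS]big_mkcond le_eqVlt; apply/orP; left; apply/eqP.
by apply: eq_bigr => e _; rewrite mxE enum_rankK; case: adj.
Qed.

(* The eigenvalues of the nonbacktracking matrix come from those of the
   adjacency operator through [x + q / x = a]. *)
Lemma eigenvalue_of_function (h : V -> F) (a x : F) :
  (forall y, \sum_(e | t (i e) == y) h (t e) = a * h y) ->
  x ^+ 2 - a * x + q%:R = 0 ->
  (exists e, h (t e) - x * h (t (i e)) != 0) -> eigenvalue T x.
Proof.
move=> ah xa [e0 he0]; apply/eigenvalueP.
pose v e := h (t e) - x * h (t (i e)).
exists (\row_c v (enum_val c)); last first.
  apply: contra_neq he0 => /rowP/(_ (enum_rank e0)); by rewrite !mxE enum_rankK.
apply/rowP => c; rewrite !mxE (reindex (@enum_rank E)) /=; last first.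
  exact/onW_bij/enum_rank_bij.
set f := enum_val c; set y := t (i f).
transitivity (\sum_(e | (t (i e) == y) && (e != f)) v (i e)).
  rewrite (reindex_inj (inv_inj iK)) /= [RHS]big_mkcond /=; apply: eq_bigr => e _.
  rewrite !mxE enum_rankK /adj /nonback iK [f == e]eq_sym -/f -/y.
  by case: (_ && _); rewrite ?mulr1 ?mulr0.
(* The quadratic equation turns [q + 1 - x a] into [1 - x^2]; taking away the term of [f], which is
   [h y - x h (t f)], leaves [x * v f]. *)
have : \sum_(e | t (i e) == y) v (i e) = (q.+1%:R - x * a) * h y.
  rewrite /v; under eq_bigr => e do rewrite iK.
  rewrite sumrB -mulr_sumr ah mulrBl mulrA; congr (_ - _).
  rewrite (eq_bigr (fun=> h y)) => [|e /eqP -> //].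
  rewrite sumr_const (_ : #|_| = q.+1) ?mulr_natl //; exact: deg.
rewrite (bigD1 f) /= ?eqxx // => /(canRL (addKr _)) ->.
rewrite /v iK -/y; have -> : q.+1%:R - x * a = 1 - x ^+ 2.
  by rewrite -natr1 -[LHS]addr0 -(subrr (x ^+ 2 - a * x + q%:R)) {1}xa; ring.
ring.
Qed.

End RegularGraph.

(** * Bounds on pole-free regions from real eigenfunctions of the adjacency operator *)

Section RegularGogZeta.
Variables (V E : finType) (t : E -> V) (i : E -> E).
Hypotheses (iK : involutive i) (i_neq : forall e, i e <> e).
Variables (conn : connected_graph (simple_graph t iK i_neq)) (b : V).
Variables (q : nat) (q_gt1 : (1 < q)%N).
Hypothesis deg : forall x, #|[pred e | t (i e) == x]| = q.+1.
Variable R : realType.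

Notation X := (trivial_gog conn b).

Lemma zeta_regular_gog : exists Z : R[i] -> R[i],
  [/\ zeta_continuation X Z, ((q%:R^-1 : R)%:E <= pole_free_sup X Z)%E &
   forall (h : V -> R) (a x : R), 0 < x -> x < q%:R ->
     (forall y, \sum_(e | t (i e) == y) h (t e) = a * h y) ->
     x ^+ 2 - a * x + q%:R = 0 ->
     (exists e, h (t e) - x * h (t (i e)) != 0) ->
     (pole_free_sup X Z <= (x^-1)%:E)%E].
Proof.
have [e0 _] : exists e : E, e \in [pred e | t (i e) == b].
  by apply/card_gt0P; rewrite deg.
have [lam [lamE lam_eig]] := trace_pow_eigenvalues (adjmx R[i] (adj t i)).
pose P := short_classes conn b; pose M := #|E|.
have M_gt0 : (0 < M)%N by apply/card_gt0P; exists e0.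
have qM : (q <= M)%N.
  by apply: (@leq_trans q.+1) => //; rewrite -(deg b); exact: max_card.
have N_lam n : (0 < n)%N ->
    (\sum_(c <- P n | (class_length c %| n)%N) class_length c)%N%:R =
    \sum_(x <- lam) x ^+ n.
  by move=> n0; rewrite count_closed_words // -trace_adjmx // lamE.
have N_le n : (0 < n)%N ->
    (\sum_(c <- P n | class_length c %| n) class_length c <= M ^ n)%N.
  by move=> n0; rewrite count_closed_words // -card_tuple max_card.
have lam_le x : x \in lam -> `|x| <= q%:R.
  by rewrite lam_eig; exact: eigenvalue_le.
have q_lam : q%:R \in lam.
  (* The constant function has adjacency eigenvalue [q + 1], and [q] is a root of
     [x^2 - (q + 1) x + q]. The resulting vector has entries [1 - q], nonzero because [q > 1]. *)
  rewrite lam_eig; apply: (eigenvalue_of_function iK deg (h := fun=> 1) (a := q.+1%:R)).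
  - move=> y; rewrite sumr_const mulr1; congr (_ *+ _); exact: deg.
  - by rewrite -natr1; ring.
  - by exists e0; rewrite mulr1 subr_eq0 eq_sym pnatr_eq1 gtn_eqF.
have inP := @in_short_classes _ _ _ _ iK i_neq conn b.
have l0 := @class_length_gt0 _ _ _ _ iK i_neq conn b.
have q_gt0 : (0 < q)%N by exact: ltnW.
exists (zeta_fun lam); split.
- exact: (zeta_continuation_zeta_fun l0 inP M_gt0 N_lam N_le qM lam_le).
- exact: (pole_free_sup_ge l0 inP M_gt0 N_lam N_le q_gt0 qM lam_le q_lam).
move=> h a x x0 xq ha xa [e he].
apply: (pole_free_sup_le l0 inP M_gt0 N_lam N_le q_gt0 qM lam_le q_lam x0 xq).
rewrite lam_eig.
apply: (eigenvalue_of_function iK deg (h := fun y => (h y)%:C%C) (a := a%:C%C)).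
- by move=> y; rewrite -rmorph_sum ha rmorphM.
- by rewrite -(rmorph_nat (real_complex R)) -rmorphXn -rmorphM -rmorphB -rmorphD xa rmorph0.
- by exists e; rewrite -rmorphM -rmorphB fmorph_eq0.
Qed.

End RegularGogZeta.

(** * Prisms with multiple rungs *)

Section Prism.
Variables (n m : nat).
Hypothesis m_gt0 : (0 < m)%N.

Definition prism_vert : finType := ('I_n.+1 * bool)%type.
(* The label [inl k] stands for the [k]-th rung, [inr true] and [inr false] for
   the two directions of the cycle. *)
Definition prism_edge : finType := (prism_vert * ('I_m + bool))%type.

Definition prism_inv (e : prism_edge) : prism_edge :=
  match e with
  | (v, inl k) => ((v.1, ~~ v.2), inl k)
  | (v, inr true) => ((ordS v.1, v.2), inr false)
  | (v, inr false) => ((ord_pred v.1, v.2), inr true)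
  end.
Definition prism_tgt (e : prism_edge) : prism_vert := (prism_inv e).1.

Lemma prism_invK : involutive prism_inv.
Proof.
by case=> [[j s] [k|[]]]; rewrite /= ?negbK ?ordSK ?ord_predK.
Qed.

(** Rungs change side and cycle edges change label, so even the loops of a cycle of length one are
    inverted without fixed points. *)
Lemma prism_inv_neq e : prism_inv e <> e.
Proof. by case: e => [[j s] [k|[]]] [] //; case: s. Qed.

Lemma prism_src e : prism_tgt (prism_inv e) = e.1.
Proof. by rewrite /prism_tgt prism_invK. Qed.

Definition prism := simple_graph prism_tgt prism_invK prism_inv_neq.

(** A general monoid law lets one computation give both the degree and the adjacency operator. *)
Lemma prism_big (T : Type) (idx : T) (op : Monoid.com_law idx) (f : prism_edge -> T) v :
  \big[op/idx]_(e | prism_tgt (prism_inv e) == v) f e =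
  op (\big[op/idx]_k f (v, inl k)) (op (f (v, inr true)) (f (v, inr false))).
Proof.
rewrite (eq_bigl (fun e : prism_edge => (e.1 == v) && xpredT e.2)); last first.
  by move=> e; rewrite prism_src andbT.
rewrite (eq_bigr (fun e : prism_edge => f (e.1, e.2))); last by case.
rewrite -(pair_big (fun w => w == v) xpredT (fun w k => f (w, k))) /= big_pred1_eq.
by rewrite big_sumType big_bool.
Qed.

Lemma prism_degree v : #|[pred e | prism_tgt (prism_inv e) == v]| = m.+2.
Proof.
by rewrite -sum1_card (prism_big _ (fun=> 1%N)) /= sum1_card card_ord addn2.
Qed.

Lemma walk_cat (G : graph) k l (x y z : vert G) :
  walk k x y -> walk l y z -> walk (k + l) x z.
Proof.
elim: k x => [|k IHk] x /=; first by move=> ->.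
by move=> [e [ex ey]] yz; exists e; split=> //; exact: IHk.
Qed.

Lemma walk_rev (G : graph) k (x y : vert G) : walk k x y -> walk k y x.
Proof.
elim: k x => [|k IHk] x /=; first by move=> ->.
move=> [e [<- /IHk ey]].
have h : walk 1 (tgt e) (src e) by exists (einv e); rewrite /src einvK.
by have := walk_cat ey h; rewrite addn1.
Qed.

Lemma prism_connected : connected_graph prism.
Proof.
have step (e : prism_edge) : walk (G := prism) 1 (e.1 : vert prism) (prism_tgt e).
  by exists (e : edge prism); split=> //; exact: prism_src.
have h0 j s : exists k, walk (G := prism) k (ord0, s) (j, s).
  case: j => j jn; elim: j jn => [|j IHj] jn.
    by exists 0%N => /=; congr pair; apply/val_inj.
  have [k hk] := IHj (ltnW jn); exists (k + 1)%N; apply: walk_cat hk _.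
  have := step ((Ordinal (ltnW jn), s), inr true); congr (walk _ _ _).
  by congr pair; apply/val_inj; rewrite /= modn_small.
have h1 s s' : exists k, walk (G := prism) k (ord0, s) (ord0, s').
  case: (eqVneq s s') => [->|ss]; first by exists 0%N.
  exists 1%N; have := step ((ord0, s), inl (Ordinal m_gt0)); congr (walk _ _ _).
  by congr pair; case: s s' ss => [] [].
move=> [j s] [j' s']; have [k hk] := h0 j s; have [k' hk'] := h0 j' s'.
have [k1 hk1] := h1 s s'; exists (k + (k1 + k'))%N.
by apply: walk_cat (walk_rev hk) _; exact: walk_cat hk1 hk'.
Qed.

Variable R : realType.

Definition prism_angle : R := 2 * pi / n.+1%:R.
(** The real part of a character of the cyclic group. It ignores the side, so each rung contributes
    the value at the vertex itself. *)
Definition prism_fun (v : prism_vert) : R := cos (prism_angle * (v.1 : nat)%:R).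

Lemma prism_angle_full : prism_angle * n.+1%:R = 2 * pi.
Proof. by rewrite /prism_angle divfK // pnatr_eq0. Qed.

Lemma prism_fun_ordS j s : prism_fun (ordS j, s) = cos (prism_angle * j%:R + prism_angle).
Proof.
rewrite /prism_fun /=; have := ltn_ord j; rewrite leq_eqVlt => /orP[/eqP jn|jn].
  have -> : (j.+1 %% n.+1 = 0)%N by rewrite jn modnn.
  rewrite mulr0 cos0 -[X in _ + X]mulr1 -mulrDr natr1 jn prism_angle_full.
  by rewrite mulr_natl cos2pi.
by rewrite modn_small // -natr1 mulrDr mulr1.
Qed.

Lemma prism_fun_ord_pred j s :
  prism_fun (ord_pred j, s) = cos (prism_angle * j%:R - prism_angle).
Proof.
rewrite /prism_fun /=; case: (posnP j) => j0.
  rewrite j0 add0n /= modn_small // mulr0 sub0r cosN.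
  have -> : prism_angle * n%:R = - prism_angle + pi *+ 2.
    by rewrite -[pi *+ 2]mulr_natl -prism_angle_full -natr1; ring.
  by rewrite cosD cos2pi sin2pi mulr1 mulr0 subr0 cosN.
have -> : ((j + n.+1).-1 %% n.+1 = j.-1)%N.
  by rewrite -subn1 -addnBAC // subn1 modnDr modn_small // (leq_ltn_trans (leq_pred _)).
by rewrite -[in RHS](prednK j0) -natr1; congr cos; ring.
Qed.

Lemma prism_fun_eigen v : \sum_(e | prism_tgt (prism_inv e) == v) prism_fun (prism_tgt e) =
  (m%:R + 2 * cos prism_angle) * prism_fun v.
Proof.
case: v => j s; rewrite (prism_big _ (fun e => prism_fun (prism_tgt e))).
rewrite [prism_fun (prism_tgt (_, inr true))]prism_fun_ordS.
rewrite [prism_fun (prism_tgt (_, inr false))]prism_fun_ord_pred.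
rewrite (eq_bigr (fun=> prism_fun (j, s))) // sumr_const card_ord cosD cosB /=.
rewrite /prism_fun /= -mulr_natl; ring.
Qed.

End Prism.

(** * A real eigenvalue below [q] that tends to [q] *)

Section SecondEigenvalue.
Variables (R : realType) (q : nat).
Hypothesis q_gt1 : (1 < q)%N.

Definition second_trace (n : nat) : R := q.-1%:R + 2 * cos (prism_angle n R).
(** The larger root of [x^2 - a x + q] for [a = second_trace n]. Since [Num.sqrt] is 0 on negative
    numbers, it is a root only once the discriminant is nonnegative, which holds for large [n] by
    [cvg_disc]. *)
Definition second_eigenvalue n : R :=
  (second_trace n + Num.sqrt (second_trace n ^+ 2 - 4 * q%:R)) / 2.

Lemma cvg_second_trace : second_trace @ \oo --> (q%:R + 1 : R).
Proof.
have -> : q%:R + 1 = q.-1%:R + 2 * 1 :> R.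
  by rewrite -[in LHS](prednK (ltnW q_gt1)) -natr1; ring.
apply: cvgD; first exact: cvg_cst.
apply: cvgM; first exact: cvg_cst.
have angle0 : prism_angle n R @[n --> \oo] --> (0 : R).
  rewrite -(mulr0 (2 * pi)); apply: cvgM; first exact: cvg_cst.
  exact: cvg_harmonic.
by rewrite -cos0; apply: continuous_cvg angle0; exact: continuous_cos.
Qed.

Lemma cvg_disc : second_trace n ^+ 2 - 4 * q%:R @[n --> \oo] --> ((q%:R - 1) ^+ 2 : R).
Proof.
have -> : (q%:R - 1) ^+ 2 = (q%:R + 1) ^+ 2 - 4 * q%:R :> R by ring.
apply: cvgB; last exact: cvg_cst.
by under eq_fun do rewrite expr2; rewrite expr2; apply: cvgM; exact: cvg_second_trace.
Qed.

Lemma cvg_second_eigenvalue : second_eigenvalue @ \oo --> (q%:R : R).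
Proof.
have q1 : 0 <= q%:R - 1 :> R by rewrite subr_ge0 ler1n ltnW.
have -> : q%:R = (q%:R + 1 + Num.sqrt ((q%:R - 1) ^+ 2)) / 2 :> R.
  by rewrite sqrtr_sqr ger0_norm //; field.
apply: cvgM; last exact: cvg_cst.
apply: cvgD; first exact: cvg_second_trace.
by apply: continuous_cvg; [exact: sqrt_continuous | exact: cvg_disc].
Qed.

(** For [n > 0] the angle lies in []0, pi]], where the cosine is below [1]; for [n = 0] it is [2 pi]
    and equality holds. *)
Lemma second_trace_lt n : (0 < n)%N -> second_trace n < q%:R + 1.
Proof.
have qE : q%:R = q.-1%:R + 1 :> R by rewrite natr1 prednK // ltnW.
move=> n0; suff : cos (prism_angle n R) < 1 by rewrite /second_trace qE; lra.
have p0 := pi_gt0 R; have a0 : 0 < prism_angle n R by rewrite divr_gt0 ?mulr_gt0.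
rewrite -cos0 ltr_cos // in_itv /= ?lexx ?(ltW p0) // (ltW a0) /=.
by rewrite ler_pdivrMr // mulrC ler_pM2l // ler_nat ltnS.
Qed.

Lemma second_eigenvalueP n : (0 < n)%N ->
  0 <= second_trace n ^+ 2 - 4 * q%:R -> 0 < second_trace n ->
  [/\ 0 < second_eigenvalue n, second_eigenvalue n < q%:R &
      second_eigenvalue n ^+ 2 - second_trace n * second_eigenvalue n + q%:R = 0].
Proof.
move=> n0 disc0 t0; have tq := second_trace_lt n0.
have q2 : 2 <= q%:R :> R by rewrite ler_nat.
rewrite /second_eigenvalue; set s := Num.sqrt _.
have s0 : 0 <= s by exact: sqrtr_ge0.
have ss : s ^+ 2 = second_trace n ^+ 2 - 4 * q%:R by rewrite sqr_sqrtr.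
split.
- by rewrite divr_gt0 // ltr_wpDr.
(* With [t] for the trace the claim is [s < 2 q - t], and [(2 q - t)^2 - (t^2 - 4 q) = 4 q (q + 1 -
   t)]. *)
- rewrite ltr_pdivrMr // -ltrBrDl.
  rewrite -(@ltr_pXn2r _ 2) ?nnegrE //; last by lra.
  by rewrite ss; nra.
- have -> : ((second_trace n + s) / 2) ^+ 2 =
      (second_trace n ^+ 2 + 2 * second_trace n * s + s ^+ 2) / 4.
    by field.
  by rewrite ss; field.
Qed.

End SecondEigenvalue.

Theorem theorem1p3 (R : realType) (q : nat) (q_ge2 : (2 <= q)%N) :
  exists (X : nat -> graph_of_groups) (Z : nat -> R[i] -> R[i]),
    (forall N, (1 <= N)%N ->
       regular_gog q.+1 (X N) /\ zeta_continuation (X N) (Z N)) /\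
    pole_free_sup (X N) (Z N) @[N --> \oo] --> ((q%:R : R)^-1)%:E.
Proof.
have m_gt0 : (0 < q.-1)%N by rewrite -ltnS prednK // ltnW.
have deg n (v : prism_vert n) :
    #|[pred e : prism_edge n q.-1 | prism_tgt (prism_inv e) == v]| = q.+1.
  by rewrite prism_degree prednK // ltnW.
pose v0 n : prism_vert n := (ord0, false).
pose X n := trivial_gog (@prism_connected n _ m_gt0) (v0 n).
have zetaX n := zeta_regular_gog (@prism_connected n _ m_gt0) (v0 n) q_ge2 (deg n) R.
have [Z HZ] := choice zetaX.
exists X, Z; split=> [N _|].
  split; first by apply: regular_trivial_gog; exact: deg.
  by have [] := HZ N.
have q0 : 0 < q%:R :> R by rewrite ltr0n ltnW.
(* The lower bound holds for every [N], the upper one only eventually, once the discriminant and the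
   trace are positive. *)
apply: (@squeeze_cvge _ _ _ _ (fun=> (q%:R^-1)%:E) _
  (fun N => ((second_eigenvalue R q N)^-1)%:E)).
- have near_disc : \forall N \near \oo, 0 < second_trace R q N ^+ 2 - 4 * q%:R.
    apply: (cvgr_gt ((q%:R - 1) ^+ 2)); first exact: cvg_disc.
    by rewrite exprn_gt0 // subr_gt0 ltr1n.
  have near_trace : \forall N \near \oo, 0 < second_trace R q N.
    apply: (cvgr_gt (q%:R + 1)); first exact: cvg_second_trace.
    by rewrite ltr_wpDl // ltW.
  near=> N; have [_ -> /= hle] := HZ N.
  have N0 : (0 < N)%N by near: N; exists 1%N.
  have d0 : 0 < second_trace R q N ^+ 2 - 4 * q%:R by near: N.
  have t0 : 0 < second_trace R q N by near: N.
  have [x0 xq xE] := second_eigenvalueP q_ge2 N0 (ltW d0) t0.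
  apply: (hle (@prism_fun N R) (second_trace R q N)) => //.
    by move=> v; exact: prism_fun_eigen.
  (* Both ends of this rung have value [1], so the entry is [1 - x]; [x = 1] would make the trace
     equal to [q + 1]. *)
  exists (v0 N, inl (Ordinal m_gt0)).
  rewrite prism_src /prism_fun /= mulr0 cos0 mulr1 subr_eq0.
  apply/eqP => x1; have := second_trace_lt R q_ge2 N0.
  by move: xE; rewrite -x1; lra.
- exact: cvg_cst.
- apply/fine_cvgP; split; first exact: nearW.
  by apply: cvgV; [exact: lt0r_neq0 | exact: cvg_second_eigenvalue].
Unshelve. all: by end_near. Qed.
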